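(* Let $k\ge 3$ and $l\ge 1$ be integers such that $k-l$ is the order of a finite field. Then there exists an infinite sequence $(X_i)_{i\in I}$ of connected $k$-regular simple finite graphs with increasing numbers of vertices, each $X_i$ being obtained from a Ramanujan graph of degree $k-l+1$ by successively adding $l-1$ perfect matchings (each one a perfect matching of the complement of the graph obtained so far), such that $$\lambda_1(X_i)\le l-1+2\sqrt{k-l}\qquad\text{for all } i\in I.$$ In particular, for $k=7$ (taking $l=2$), there is such a sequence of $7$-regular graphs, each obtained from a $6$-regular Ramanujan graph by adding one perfect matching of its complement, whose spectral gaps satisfy $$7-\lambda_1(X_i)\ge 6-2\sqrt{5}\qquad\text{for all } i\in I.$$
   Context: For a simple finite graph $X=(V,E)$ with $n$ vertices, $\lambda_0(X)\ge\lambda_1(X)\ge\cdots\ge\lambda_{n-1}(X)$ denote the eigenvalues, with multiplicity, of its adjacency matrix. If $X$ is $k$-regular then $\lambda_0(X)=k$, and the spectral gap is $\lambda_0(X)-\lambda_1(X)=k-\lambda_1(X)$. A $d$-regular simple finite graph $X$ is a Ramanujan graph if it is connected and $|\mu|\le 2\sqrt{d-1}$ for every eigenvalue $\mu\ne\pm d$ of $X$. A perfect matching ($1$-factor) of a graph is a subset $F$ of its edge set such that every vertex is incident with exactly one edge of $F$. Complement: if $X$ is not bipartite, $\overline{X}=(V,\overline{E})$ is the usual complement. If $X$ is bipartite, given with a bipartition $V=V_0\sqcup V_1$, $\overline{X}$ is the bipartite complement ($v\in V_0$ and $w\in V_1$ are adjacent in $\overline{X}$ if and only if they are not adjacent in $X$,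 and there are no edges inside $V_0$ or inside $V_1$). Adding to $X$ a perfect matching $F$ of $\overline{X}$ means passing to the graph $X+F=(V,E\cup F)$. *)

(* Defs.v *)
From HB Require Import structures.
From mathcomp Require Import all_boot all_order all_algebra.
From mathcomp Require Import polyrcf.

Set Implicit Arguments.
Unset Strict Implicit.
Unset Printing Implicit Defensive.

Import Order.TTheory GRing.Theory Num.Theory.
Local Open Scope ring_scope.

(* Simple graphs on the finite vertex set T: an edge is a two-element set of
   vertices, so there are no loops and no multiple edges. *)
Record sgraph (T : finType) := SGraph {
  edges : {set {set T}};
  edges_card2 : [forall f in edges, #|f| == 2%N] }.

Section Graphs.
Variable T : finType.
Implicit Types (X Y Z : sgraph T) (F : {set {set T}}).

Definition adj X : rel T := fun v w => [set v; w] \in edges X.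

Definition regular (k : nat) X : Prop :=
  forall v, #|[set w | adj X v w]| = k.

(* The graph without vertices is not connected. *)
Definition connected X : Prop :=
  (0 < #|T|)%N /\ forall v w, connect (adj X) v w.

(* V0 and its complement ~: V0 are the two parts; either may be empty. *)
Definition bipartition X (V0 : {set T}) : Prop :=
  forall v w, adj X v w -> (v \in V0) != (w \in V0).

Definition bipartite X : Prop := exists V0, bipartition X V0.

Definition compl_edges X : {set {set T}} :=
  [set f : {set T} | (#|f| == 2%N) && (f \notin edges X)].

Lemma compl_edges_card2 X : [forall f in compl_edges X, #|f| == 2%N].
Proof. by apply/forall_inP => f; rewrite inE => /andP[]. Qed.

Definition compl X : sgraph T := SGraph (compl_edges_card2 X).

Definition bicompl_edges X (V0 : {set T}) : {set {set T}} :=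
  [set [set v; w] | v in V0, w in ~: V0 & ~~ adj X v w].

Lemma bicompl_edges_card2 X (V0 : {set T}) :
  [forall f in bicompl_edges X V0, #|f| == 2%N].
Proof.
apply/forall_inP => f /imset2P[v w v0].
rewrite !inE => /andP[w0 _] ->; rewrite cards2.
by case: (eqVneq v w) => // vw; rewrite -vw v0 in w0.
Qed.

Definition bicompl X (V0 : {set T}) : sgraph T := SGraph (bicompl_edges_card2 X V0).

(* Xbar is the complement of X: the bipartite one if X is bipartite, the usual
   one otherwise. A connected bipartite graph has a single bipartition up to
   exchanging the parts, hence a single bipartite complement. *)
Definition is_complement X Xbar : Prop :=
  (exists2 V0, bipartition X V0 & Xbar = bicompl X V0) \/
  (~ bipartite X /\ Xbar = compl X).

Definition perfect_matching X F : Prop :=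
  F \subset edges X /\ forall v, #|[set f in F | v \in f]| = 1%N.

(* Y = X + F for some perfect matching F of the complement of X. *)
Definition add_matching X Y : Prop :=
  exists Xbar F, [/\ is_complement X Xbar, perfect_matching Xbar F &
                     edges Y = edges X :|: F].

(* Y is obtained from X by m successive additions of a perfect matching, each
   one in the complement of the graph obtained so far. *)
Fixpoint add_matchings (m : nat) X Y : Prop :=
  if m is m'.+1 then exists Z, add_matching X Z /\ add_matchings m' Z Y
  else Y = X.

Section Spectrum.
Variable R : rcfType.

Definition adjmx X : 'M[R]_#|T| :=
  \matrix_(i, j) (adj X (enum_val i) (enum_val j))%:R.

(* rootsR lists the distinct roots in R of a polynomial in increasing order; as
   adjmx X is symmetric, its characteristic polynomial has all its roots in R,
   so that the spectrum has #|T| terms. *)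
Definition spectrum X : seq R :=
  let p := char_poly (adjmx X) in
  rev (flatten [seq nseq (mup x p) x | x <- rootsR p]).

Definition lambda X (i : nat) : R := (spectrum X)`_i.

Definition spectral_gap X : R := lambda X 0 - lambda X 1.

Definition ramanujan (d : nat) X : Prop :=
  [/\ regular d X, connected X &
      forall mu : R, eigenvalue (adjmx X) mu -> mu != d%:R -> mu != - d%:R ->
        `|mu| <= 2 * Num.sqrt (d%:R - 1)].

End Spectrum.
End Graphs.

Arguments adjmx {T} R X.
Arguments spectrum {T} R X.
Arguments lambda {T} R X i.
Arguments spectral_gap {T} R X.
Arguments ramanujan {T} R d X.

(* Main.v *)
From mathcomp Require topology normedtype derive realfun.
Require Import Defs.
From HB Require Import structures.
From mathcomp Require Import all_boot all_order all_algebra.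
From mathcomp Require Import perm ring lra zify.
From mathcomp Require Import boolp reals complex polyrcf.

Set Implicit Arguments.
Unset Strict Implicit.
Unset Printing Implicit Defensive.

Import Order.TTheory GRing.Theory Num.Theory.
Local Open Scope ring_scope.
Local Open Scope sesquilinear_scope.

(** With q = k - l, the Ramanujan graphs used here are bipartite of degree
    q + 1 >= 3 and come from the theorem of Marcus, Spielman and Srivastava on
    2-lifts.  A signing s of the edges of a graph defines a 2-lift on pairs
    (vertex, sign).  Functions on the lift split into an even part, on which
    the adjacency form of the lift is twice that of the original graph, and an
    odd part, on which it is twice the form of the signed adjacency matrix A_s
    ([biform_lift2]).  If the eigenvalues of A_s are at most 2 sqrt q, the lift
    is again Ramanujan; iterating from the complete bipartite graph gives
    infinitely many graphs ([ramanujan_tower]).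

    Such an s exists for every graph of maximal degree q + 1 >= 2
    ([exists_small_signing]).  The average over all s of det (x - A_s) is the
    matching polynomial of the graph; its recursion ([signed_sum_rec]) gives
    the bound of Heilmann and Lieb: it is positive for x > 2 sqrt q
    ([signed_sum_bound]).  To pass from the average to one signing, the signs
    are fixed one edge at a time ([interlacing_selection]).  At each step a
    polynomial which is positive beyond 2 sqrt q is the sum of the two obtained
    by fixing the next sign, and one of these is still positive there: all
    nonnegative combinations of the two are real-rooted
    ([sumpoly_mix_real_rooted]), and this excludes that both have a larger root
    ([common_interlacing]).  Real-rootedness is a stability statement.  Up to a
    fixed diagonal matrix, - A_s is a sum of matrices r^T r, one for each edge,
    and averaging over the two vectors r of an edge turns a functional without
    zeros on the matrices with positive definite imaginary part into another
    one ([stable_mix]), as long as it is affine in rank-one directions.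

    The perfect matchings are explicit.  A perfect matching between the two
    parts has two disjoint lifts, so that after m steps the identity matching of
    the complete bipartite graph has become 2 ^ m disjoint perfect matchings, of
    which exactly one consists of edges ([lift2_matchings]); any l - 1 of the
    others can be added.  A matching increases the adjacency form by at most
    the squared norm, so that on vectors orthogonal to the constants the form
    of the final graph is at most (l - 1 + 2 sqrt q) times the squared norm.
    By the spectral theorem at most one eigenvalue, counted with multiplicity,
    then exceeds this number ([qform_one_large]), which bounds lambda_1. *)

(** * Functionals affine in rank-one directions *)

Section RankOne.
Variables (K : comNzRingType) (n : nat).

(** Bordering turns the rank-one perturbation u v of M into the row v, in which
    the determinant is affine. *)
Lemma det_rank1 (M : 'M[K]_n) (u : 'cV_n) (v : 'rV_n) :
  \det (block_mx 1%:M v (- u) M) = \det (M + u *m v).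
Proof.
have -> : block_mx 1%:M v (- u) M
        = block_mx 1%:M 0 (- u) 1%:M *m block_mx 1%:M v 0 (M + u *m v).
  by rewrite mulmx_block !mul1mx !mul0mx !mulmx1 !addr0 mulNmx addrC addrK.
by rewrite det_mulmx det_lblock det_ublock !det1 !mul1r.
Qed.

Definition rank1_affine (Phi : 'M[K]_n -> K) := forall M (r : 'rV_n) a,
  Phi (M + a *: (r^T *m r)) = (1 - a) * Phi M + a * Phi (M + r^T *m r).

Lemma det_rank1_affine : rank1_affine (fun M => \det M).
Proof.
move=> M r a.
have -> : M + a *: (r^T *m r) = M + r^T *m (a *: r) by rewrite scalemxAr.
have {2}-> : M = M + r^T *m 0 by rewrite mulmx0 addr0.
rewrite -!det_rank1.
apply: (@determinant_multilinear _ _ _ _ _ (lshift n ord0)).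
- apply/rowP => j; rewrite !mxE.
  case: (splitP (lshift n ord0)) => [i _|i /= ji]; last by [].
  rewrite !mxE; case: (splitP j) => k _; rewrite !mxE; first by ring.
  by rewrite mulr0 add0r.
- apply/matrixP => i j; rewrite !mxE.
  case: splitP => [k|k _]; last by rewrite !mxE.
  by rewrite (ord1 k) => /= /eqP; rewrite /bump leq0n.
- apply/matrixP => i j; rewrite !mxE.
  case: splitP => [k|k _]; last by rewrite !mxE.
  by rewrite (ord1 k) => /= /eqP; rewrite /bump leq0n.
Qed.

Variables (I : Type) (r : I -> bool -> 'rV[K]_n).

(** The sum of det (M + \sum_e r_e^T r_e) over all choices of one of the two
    vectors r e false, r e true for each e in l, organized one e at a time. *)
Fixpoint sumdet (l : seq I) (M : 'M[K]_n) : K :=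
  if l is e :: l' then sumdet l' (M + (r e false)^T *m r e false)
                     + sumdet l' (M + (r e true)^T *m r e true)
  else \det M.

Lemma rank1_affine_mix (Phi : 'M[K]_n -> K) (r0 r1 : 'rV[K]_n) p q :
  rank1_affine Phi ->
  rank1_affine (fun M => p * Phi (M + r0^T *m r0) + q * Phi (M + r1^T *m r1)).
Proof.
move=> aff M s a; rewrite ![M + _ *: _ + _]addrAC ![M + s^T *m s + _]addrAC !aff.
by ring.
Qed.

End RankOne.

Lemma eq_sumdet (K : comNzRingType) n (I : Type) (r r' : I -> bool -> 'rV[K]_n) l M :
  (forall e b, r e b = r' e b) -> sumdet r l M = sumdet r' l M.
Proof. by move=> rr; elim: l M => [|e l IHl] M //=; rewrite !IHl !rr. Qed.

Lemma map_sumdet (K L : comNzRingType) (f : {rmorphism K -> L}) n (I : Type)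
    (r : I -> bool -> 'rV[K]_n) l M :
  f (sumdet r l M) = sumdet (fun e b => map_mx f (r e b)) l (map_mx f M).
Proof.
elim: l M => [|e l IHl] M /=; first by rewrite det_map_mx.
by rewrite rmorphD /= !IHl !map_mxD !map_mxM !map_trmx.
Qed.

(** * Stability: no zeros on the upper half space of matrices *)

Section Stability.
Variables (C : numClosedFieldType) (n : nat).
Implicit Types (M : 'M[C]_n) (Phi : 'M[C]_n -> C).

(** If k c0 + c1 = 0, the reciprocals of the roots of c0 + c1 t + c2 t^2 sum to
    the real number k > 0, so one of them is nonzero with imaginary part <= 0
    and its inverse is a root with imaginary part >= 0. *)
Lemma quadratic_halfplane (k c0 c1 c2 : C) : 0 < k ->
  (forall t, 0 <= 'Im t -> c0 + c1 * t + c2 * t ^+ 2 != 0) ->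
  k * c0 + c1 != 0.
Proof.
move=> k0 nz; apply/eqP => E.
have c00 : c0 != 0.
  by move: (nz 0); rewrite raddf0 lexx mulr0 expr0n mulr0 !addr0; apply.
have kr : 'Im k = 0 by apply/Creal_ImP/gtr0_real.
have c1E : c1 = - (k * c0) by apply/eqP; rewrite -addr_eq0 addrC E.
pose c := c2 / c0.
have c2E : c2 = c * c0 by rewrite divfK.
(* 1 / w is a root as soon as w is a root of the reversed quadratic. *)
have root_absurd w : w != 0 -> 'Im w <= 0 -> w ^+ 2 - k * w + c = 0 -> False.
  move=> w0 imw wE.
  have := nz w^-1; rewrite ImV divr_ge0 ?oppr_ge0 ?exprn_ge0 // => /(_ isT)/eqP.
  apply; have -> : c0 + c1 / w + c2 * w^-1 ^+ 2 = c0 / w ^+ 2 * (w ^+ 2 - k * w + c).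
    by rewrite c1E c2E; field.
  by rewrite wE mulr0.
pose s := sqrtC (k ^+ 2 - 4 * c).
have s2 : s ^+ 2 = k ^+ 2 - 4 * c by rewrite sqrtCK.
pose w1 := (k + s) / 2; pose w2 := (k - s) / 2.
have w1E : w1 ^+ 2 - k * w1 + c = 0.
  have -> : w1 ^+ 2 - k * w1 + c = (s ^+ 2 - (k ^+ 2 - 4 * c)) / 4.
    by rewrite /w1; field.
  by rewrite s2 subrr mul0r.
have w2E : w2 ^+ 2 - k * w2 + c = 0.
  have -> : w2 ^+ 2 - k * w2 + c = (s ^+ 2 - (k ^+ 2 - 4 * c)) / 4.
    by rewrite /w2; field.
  by rewrite s2 subrr mul0r.
have sumw : w1 + w2 = k by rewrite /w1 /w2; field.
have imsum : 'Im w1 + 'Im w2 = 0 by rewrite -raddfD /= sumw kr.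
have [w10|w10] := eqVneq w1 0.
  move: sumw; rewrite w10 add0r => w2k; apply: (root_absurd w2) => //.
    by rewrite w2k gt_eqF.
  by rewrite w2k kr.
have [w20|w20] := eqVneq w2 0.
  move: sumw; rewrite w20 addr0 => w1k; apply: (root_absurd w1) => //.
  by rewrite w1k kr.
have /orP[im1|im1] := real_leVge (Creal_Im w1) (real0 C).
  exact: (root_absurd w1).
apply: (root_absurd w2) => //.
by move/eqP: imsum; rewrite addrC addr_eq0 => /eqP->; rewrite oppr_le0.
Qed.

(** The imaginary part of the form of M is positive definite; for symmetric
    M = X + i Y with X and Y real this says that Y is. *)
Definition upper_half M := forall x : 'rV_n, x != 0 -> 0 < 'Im ((x *m M *m x^t*) 0 0).

Lemma upper_half_det M : upper_half M -> \det M != 0.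
Proof.
move=> uM; apply/det0P => -[x x0 xM]; have := uM x x0.
by rewrite xM mul0mx mxE raddf0 ltxx.
Qed.

Lemma upper_half_rank1 M (r : 'rV[C]_n) t : r \is a realmx -> upper_half M -> 0 <= 'Im t ->
  upper_half (M + t *: (r^T *m r)).
Proof.
move=> rr uM t0 x x0; rewrite mulmxDr mulmxDl mxE raddfD /=.
apply: ltr_wpDr (uM x x0).
have -> : x *m (t *: (r^T *m r)) *m x^t* = t *: ((x *m r^T) *m (x *m r^T)^t*).
  rewrite -!scalemxAr -!scalemxAl; congr (_ *: _).
  by rewrite trmx_mul map_mxM trmxK (realmxC rr) !mulmxA.
rewrite mxE [(_ *m (_ ^t*)%sesqui) _ _]mxE big_ord1 !mxE mulrC -normCK ImMl ?rpredX ?normr_real //.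
by rewrite mulr_ge0 ?exprn_ge0.
Qed.

Lemma hermitian_form_real M (x : 'rV[C]_n) : M^t* = M -> 'Im ((x *m M *m x^t*) 0 0) = 0.
Proof.
move=> MM; apply/Creal_ImP/CrealP.
have {2}-> : x *m M *m x^t* = (x *m M *m x^t*)^t*.
  by rewrite [in RHS]trmx_mul [(x *m M)^T]trmx_mul map_mxM map_mxM trmxCK MM mulmxA.
by rewrite [RHS]mxE [in RHS]mxE.
Qed.

(** Affinity in rank-one directions keeps the dependence of Phi on two such
    directions quadratic, which is all that averaging over a pair of vectors
    needs. *)
Definition stable Phi := rank1_affine Phi /\ forall M, upper_half M -> Phi M != 0.

Lemma stable_det : stable (fun M => \det M).
Proof. by split; [exact: det_rank1_affine | exact: upper_half_det]. Qed.

(** Along t (p r0^T r0 + q r1^T r1), a direction which stays in the upper half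
    space for t in the closed upper half-plane, Phi is a quadratic polynomial
    in t without zeros there; [quadratic_halfplane] applied to its first two
    coefficients is the claim. *)
Lemma stable_mix Phi (r0 r1 : 'rV[C]_n) p q :
  r0 \is a realmx -> r1 \is a realmx -> 0 <= p -> 0 <= q -> 0 < p + q ->
  stable Phi ->
  stable (fun M => p * Phi (M + r0^T *m r0) + q * Phi (M + r1^T *m r1)).
Proof.
move=> rr0 rr1 p0 q0 pq [aff nz]; split; first exact: rank1_affine_mix.
move=> M uM; set R0 := r0^T *m r0; set R1 := r1^T *m r1.
have := @quadratic_halfplane (p + q) (Phi M)
  (p * (Phi (M + R0) - Phi M) + q * (Phi (M + R1) - Phi M))
  (p * q * (Phi M + Phi (M + R0 + R1) - Phi (M + R0) - Phi (M + R1))) pq.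
have -> : forall a b c, (p + q) * a + (p * (b - a) + q * (c - a)) = p * b + q * c.
  by move=> a b c; ring.
apply=> t t0.
have pr : p \is Num.real by exact: ger0_real.
have qr : q \is Num.real by exact: ger0_real.
have : Phi (M + (p * t) *: R0 + (q * t) *: R1) != 0.
  by apply: nz; do 2?apply: upper_half_rank1 => //; rewrite ImMl // mulr_ge0.
have -> := aff (M + (p * t) *: R0) r1 (q * t); rewrite -/R1.
have -> := aff M r0 (p * t); rewrite -/R0 [M + (p * t) *: R0 + R1]addrAC.
have -> := aff (M + R1) r0 (p * t); rewrite -/R0 [M + R1 + R0]addrAC => H.
by apply: contra_neq H => H; rewrite -[RHS]H; ring.
Qed.

Lemma stable_sumdet (I : Type) (r : I -> bool -> 'rV[C]_n) l :
  (forall e b, r e b \is a realmx) -> stable (sumdet r l).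
Proof.
move=> rr; elim: l => [|e l IHl]; first exact: stable_det.
have := stable_mix (rr e false) (rr e true) ler01 ler01 (addr_gt0 ltr01 ltr01) IHl.
move=> [aff nz]; split.
  by move=> M s a; have := aff M s a; rewrite !mul1r.
by move=> M /nz; rewrite !mul1r.
Qed.

End Stability.

(** * Real-rooted polynomials and common interlacing *)

Section Minimum.
Import topology normedtype derive realfun numFieldNormedType.Exports.

Lemma quotient_min (R : realType) (f g : {poly R}) a b : a <= b ->
  (forall x, a <= x -> x <= b -> f.[x] != 0) ->
  exists2 x, x \in `[a, b] & forall t, t \in `[a, b] -> g.[x] / f.[x] <= g.[t] / f.[t].
Proof.
move=> ab f0; apply: (@EVT_min R (fun x => g.[x] / f.[x]) a b ab).
apply: continuous_in_subspaceT => x; rewrite classical_sets.inE /= in_itv /= => /andP[ax xb].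
apply: continuousM; first exact: continuous_horner.
by apply: cvgV; [exact: f0 | exact: continuous_horner].
Qed.

End Minimum.

Section RealRooted.
Variable R : realType.
Implicit Types (f g : {poly R}) (mu x : R).

Definition real_rooted f := exists s : seq R, f = lead_coef f *: \prod_(z <- s) ('X - z%:P).

Definition pos_above mu f := forall x, mu < x -> 0 < f.[x].

(** A factor x - z with z outside [a - d, a + d] satisfies
    0 <= (a - d - z) (a + d - z) = (a - z)^2 - d^2 <= (a - z)^2. *)
Lemma log_concave f a d :
  real_rooted f -> 0 <= d -> (forall x, a - d <= x <= a + d -> f.[x] != 0) ->
  f.[a - d] * f.[a + d] <= f.[a] ^+ 2.
Proof.
move=> [s ->] d0; move: (lead_coef f) => c nz.
rewrite !hornerZ mulrACA exprMn -expr2 ler_wpM2l ?sqr_ge0 //.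
have sP z : z \in s -> ~~ (a - d <= z <= a + d).
  move=> zs; apply/negP => /nz/negP; apply.
  rewrite hornerZ mulf_eq0 (_ : _.[_] == 0) ?orbT //.
  by rewrite -[_ == 0]/(root _ _) root_prod_XsubC.
rewrite !horner_prod; elim: s sP {nz} => [|z s IHs] sP.
  by rewrite !big_nil mul1r expr1n.
rewrite !big_cons mulrACA exprMn !hornerXsubC.
have /negP zP := sP z (mem_head _ _).
set u := \prod_(_ <- _) _; set v := \prod_(_ <- _) _; set w := \prod_(_ <- _) _.
have IH : u * v <= w ^+ 2 by apply: IHs => y ys; apply: sP; rewrite inE ys orbT.
have Pge0 : 0 <= (a - d - z) * (a + d - z).
  have [zl|zl] := ltP z (a - d).
    by rewrite mulr_ge0 //; lra.
  have [zr|zr] := ltP (a + d) z.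
    by rewrite mulr_le0 //; lra.
  by case: zP; rewrite zl zr.
have [uv0|uv0] := leP 0 (u * v).
  by apply: ler_pM => //; nra.
apply: (@le_trans _ _ 0); last by rewrite mulr_ge0 ?sqr_ge0.
by rewrite pmulr_rle0 //; nra.
Qed.

Lemma avoid_seq (s : seq R) e : 0 < e -> exists2 d, 0 < d < e & d \notin s.
Proof.
move=> e0; have p0 : \prod_(z <- s) ('X - z%:P) != 0 by rewrite monic_neq0 ?monic_prod_XsubC.
have [y yP] := neighpr_wit e0 p0; exists y.
  move: yP; rewrite /neighpr in_itv /= => /andP[-> /lt_le_trans]; apply.
  have := next_root_in (\prod_(z <- s) ('X - z%:P)) 0 e.
  by rewrite in_itv /= (max_l (ltW e0)) => /andP[].
by have := neighpr_root yP; rewrite root_prod_XsubC.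
Qed.

Lemma top_root mu f : 0 < lead_coef f -> real_rooted f -> ~ pos_above mu f ->
  exists b, [/\ mu < b, f.[b] = 0 & pos_above b f].
Proof.
move=> c0 [s fE] npos.
have [z zs zmu] : exists2 z, z \in s & mu < z.
  apply/hasP; apply: contra_notT npos => /hasPn sP x mux.
  rewrite fE hornerZ mulr_gt0 // horner_prod big_seq prodr_gt0 // => z zs.
  rewrite hornerXsubC subr_gt0 (le_lt_trans _ mux) //.
  by rewrite leNgt sP.
have [m ms mP] : exists2 m, m \in s & forall y, y \in s -> y <= m.
  elim: (s) z zs {zmu} => // x [|x' s'] IH z _.
    by exists x; rewrite ?mem_head // => y; rewrite inE => /eqP->.
  have [m ms mP] := IH x' (mem_head _ _); have [xm|mx] := leP x m.
    by exists m => [|y]; rewrite inE ?ms ?orbT // => /predU1P[->//|/mP].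
  exists x => [|y]; rewrite inE ?eqxx // => /predU1P[->//|/mP ym].
  exact: le_trans ym (ltW mx).
exists m; split.
- by rewrite (lt_le_trans zmu) ?mP.
- move: ms; rewrite fE hornerZ -root_prod_XsubC => /rootP ->; exact: mulr0.
- move=> x mx; rewrite fE hornerZ mulr_gt0 // horner_prod big_seq prodr_gt0 // => y ys.
  by rewrite hornerXsubC subr_gt0 (le_lt_trans _ mx) ?mP.
Qed.

(** Consider a minimum m0 of g / f on the part of (b, c] where g may be
    nonpositive, and let - m <= 0 be its value.  Then P = g + m f is nonnegative
    on (b, +oo) and vanishes at m0.  For small a > 0 the real-rooted polynomial
    P + a f is positive on (b, +oo) but arbitrarily small at m0, while it stays
    bounded below at two points on both sides of m0: this contradicts
    [log_concave]. *)
Lemma interlacing_core f g b c :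
  (forall p q, 0 <= p -> 0 <= q -> 0 < p + q -> real_rooted (p *: f + q *: g)) ->
  f.[b] = 0 -> pos_above b f -> 0 < g.[b] ->
  b < c -> g.[c] = 0 -> pos_above c g -> False.
Proof.
move=> rr fb fpos gb bc gc gpos.
have [d d0 dP] := poly_cont b g gb.
have gd y : b <= y < b + d -> 0 < g.[y].
  move=> /andP[by_ yd].
  have : `|y - b| < d by rewrite ger0_norm; lra.
  by move/dP; rewrite ltr_norml => /andP[+ _]; lra.
have dc : b + d <= c.
  by rewrite leNgt; apply/negP => cd; have := gd c; rewrite (ltW bc) cd gc ltxx => /(_ isT).
(* g is positive on [b, b'], so the minimum may be taken over [b', c], where
   f has no zero. *)
pose b' := b + d / 2.
have bb' : b < b' by rewrite /b'; lra.
have b'c : b' <= c by rewrite /b'; lra.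
have [m0 m0P m0min] : exists2 x, x \in `[b', c] &
    forall t, t \in `[b', c] -> g.[x] / f.[x] <= g.[t] / f.[t].
  apply: quotient_min => // x b'x _.
  by rewrite gt_eqF // fpos // (lt_le_trans bb').
move: m0P; rewrite in_itv /= => /andP[b'm mc].
have bm : b < m0 by exact: lt_le_trans b'm.
have fm : 0 < f.[m0] by exact: fpos.
pose m := - (g.[m0] / f.[m0]).
have m_ge0 : 0 <= m.
  by rewrite oppr_ge0 (le_trans (m0min c _)) ?in_itv /= ?b'c ?lexx // gc mul0r.
pose P := m *: f + 1 *: g.
have Pm : P.[m0] = 0.
  by rewrite !(hornerD, hornerZ) mul1r mulNr divfK ?gt_eqF // addNr.
have P_ge0 x : b < x -> 0 <= P.[x].
  move=> bx; have fx := fpos _ bx; rewrite !(hornerD, hornerZ) mul1r.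
  have mf : 0 <= m * f.[x] by rewrite mulr_ge0 // ltW.
  have [xb'|b'x] := ltP x b'.
    by rewrite addr_ge0 // ltW // gd //; move: xb'; rewrite /b'; lra.
  have [xc|cx] := leP x c.
    have := m0min x; rewrite in_itv /= b'x xc => /(_ isT).
    by rewrite -[_ / _ <= _]lerN2 -/m => /(ler_wpM2r (ltW fx)); rewrite mulNr divfK ?gt_eqF //; lra.
  by rewrite addr_ge0 // ltW // gpos.
have [s PE] : real_rooted P by apply: rr => //; rewrite ltr_wpDl.
have P0 : P != 0.
  apply/negP => /eqP P0; have : P.[c + 1] = 0 by rewrite P0 horner0.
  have := fpos (c + 1); have := gpos (c + 1).
  rewrite !(hornerD, hornerZ) mul1r ltrDl ltr01 => /(_ isT) g1 /(_ _)f1.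
  have : 0 < f.[c + 1] by apply: f1; lra.
  by move=> f1' /eqP; rewrite gt_eqF // ltr_wpDl // mulr_ge0 // ltW.
have lP : lead_coef P != 0 by rewrite lead_coef_eq0.
(* e is such that b < m0 - e and that P vanishes neither at m0 - e nor at
   m0 + e. *)
have [|e /andP[e0 em] es] := @avoid_seq ([seq z - m0 | z <- s] ++ [seq m0 - z | z <- s]) (m0 - b).
  by rewrite subr_gt0.
have noroot x : b < x -> x \notin s -> 0 < P.[x].
  move=> bx xs; rewrite lt_neqAle P_ge0 // andbT eq_sym PE hornerZ mulf_neq0 //.
  by rewrite -[_ == 0]/(root _ _) root_prod_XsubC.
move: es; rewrite mem_cat negb_or => /andP[es1 es2].
have P1 : 0 < P.[m0 - e].
  apply: noroot; first by lra.
  by apply: contra es2 => H; apply/mapP; exists (m0 - e) => //; ring.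
have P2 : 0 < P.[m0 + e].
  apply: noroot; first by lra.
  by apply: contra es1 => H; apply/mapP; exists (m0 + e) => //; ring.
set k := P.[m0 - e] * P.[m0 + e].
have k0 : 0 < k by rewrite mulr_gt0.
(* t is the value at m0 of P + a f, chosen so that its square is below the
   product k of the values of P at the two neighbouring points. *)
pose t := Num.min 1 k / 2.
have t0 : 0 < t by rewrite divr_gt0 // lt_min ltr01.
have tk : t ^+ 2 < k.
  have h1 : Num.min 1 k <= 1 by rewrite ge_min lexx.
  have h2 : Num.min 1 k <= k by rewrite ge_min lexx orbT.
  have h3 : 0 < Num.min 1 k by rewrite lt_min ltr01.
  by rewrite /t; nra.
pose a := t / f.[m0]; have a0 : 0 < a by rewrite divr_gt0.
pose F := (m + a) *: f + 1 *: g.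
have FE x : F.[x] = P.[x] + a * f.[x].
  by rewrite !(hornerD, hornerZ); ring.
have Fr : real_rooted F by apply: rr => //; lra.
have Fpos x : b < x -> 0 < F.[x].
  by move=> bx; rewrite FE ltr_wpDl ?P_ge0 // mulr_gt0 ?fpos.
have : F.[m0 - e] * F.[m0 + e] <= F.[m0] ^+ 2.
  apply: log_concave => //; first exact: ltW.
  by move=> x /andP[x1 x2]; rewrite gt_eqF // Fpos //; lra.
apply/negP; rewrite -ltNge.
have -> : F.[m0] = t by rewrite FE Pm add0r divfK // gt_eqF.
apply: (lt_le_trans tk); apply: ler_pM; rewrite ?(ltW P1) ?(ltW P2) // FE lerDl;
  by rewrite mulr_ge0 ?ltW // fpos //; lra.
Qed.

(** If both f and g had a root beyond mu, compare their largest roots b and c.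
    They differ because f + g is positive at them; if b < c, then g is positive
    at b for the same reason, and [interlacing_core] applies. *)
Lemma common_interlacing f g mu :
  0 < lead_coef f -> 0 < lead_coef g ->
  (forall p q, 0 <= p -> 0 <= q -> 0 < p + q -> real_rooted (p *: f + q *: g)) ->
  pos_above mu (f + g) -> pos_above mu f \/ pos_above mu g.
Proof.
move=> lf lg rr pos.
have [|nf] := pselect (pos_above mu f); first by left.
have [|ng] := pselect (pos_above mu g); first by right.
have rf : real_rooted f.
  by have := rr 1 0 ler01 (lexx _); rewrite addr0 scale1r scale0r addr0; apply.
have rg : real_rooted g.
  by have := rr 0 1 (lexx _) ler01; rewrite add0r scale1r scale0r add0r; apply.
have [b [mub fb fpos]] := top_root lf rf nf.
have [c [muc gc gpos]] := top_root lg rg ng.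
have [bc|cb|bc] := ltgtP b c; exfalso.
- apply: (interlacing_core rr fb fpos _ bc gc gpos).
  by have := pos _ mub; rewrite hornerD fb add0r.
- apply: (@interlacing_core g f c b) => //.
    by move=> p q p0 q0 pq; rewrite addrC; apply: rr; rewrite // addrC.
  by have := pos _ muc; rewrite hornerD gc addr0.
- by have := pos _ mub; rewrite hornerD fb bc gc addr0 ltxx.
Qed.

(** The roots of a real polynomial come in conjugate pairs, so that excluding
    the open upper half-plane leaves only real roots. *)
Lemma real_rooted_halfplane f : f != 0 ->
  (forall z : R[i], 0 < 'Im z -> ~~ root (map_poly (real_complex R) f) z) ->
  real_rooted f.
Proof.
move=> f0 nz; pose F := map_poly (real_complex R) f.
have F0 : F != 0 by rewrite map_poly_eq0.
have [r FE] := closed_field_poly_normal F.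
have rP z : (z \in r) = root F z.
  by rewrite FE rootZ ?lead_coef_eq0 // root_prod_XsubC.
have r_conj z : z \in r -> z^* \in r.
  rewrite !rP => Fz; have := complex_root_conj F z.
  have -> : map_poly conjc F = F.
    by apply/polyP => i; rewrite !coef_map /= oppr0.
  by rewrite Fz => /esym.
have r_Im z : z \in r -> 'Im z <= 0.
  move=> zr; rewrite real_leNgt ?Creal_Im ?real0 //.
  by apply/negP => /nz; rewrite -/F -rP zr.
have r_real z : z \in r -> exists x : R, z = x%:C%C.
  move=> zr; apply/complex_realP/Creal_ImP/eqP.
  by rewrite eq_le r_Im //= -oppr_le0 -Im_conj r_Im // r_conj.
have [s rE] : exists s : seq R, r = [seq x%:C%C | x <- s].
  elim: r r_real {rP r_conj r_Im FE} => [|z r IHr] r_real; first by exists [::].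
  have [x ->] := r_real z (mem_head _ _).
  have [|s ->] := IHr; last by exists (x :: s).
  by move=> y yr; apply: r_real; rewrite inE yr orbT.
exists s; apply: (map_poly_inj (real_complex R)); rewrite map_polyZ -/F FE rE.
rewrite lead_coef_map rmorph_prod big_map; congr (_ *: _).
by apply: eq_bigr => z _; rewrite /= map_polyXsubC.
Qed.

End RealRooted.

(** * Fixing one rank-one matrix after the other *)

Section Selection.
Variables (R : realType) (n : nat) (I : eqType) (r : I -> bool -> 'rV[R]_n).
Implicit Types (A : 'M[R]_n) (l : seq I).

(** The sum of the characteristic polynomials of - (A + \sum_e r_e^T r_e) over
    all choices of the vectors r_e for e in l. *)
Definition sumpoly l A : {poly R} :=
  sumdet (fun e b => map_mx polyC (r e b)) l ('X%:M + map_mx polyC A).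

Lemma sumpoly_nil A : sumpoly [::] A = \det ('X%:M + map_mx polyC A).
Proof. by []. Qed.

Lemma sumpoly_cons e l A :
  sumpoly (e :: l) A = sumpoly l (A + (r e false)^T *m r e false)
                     + sumpoly l (A + (r e true)^T *m r e true).
Proof.
by rewrite /sumpoly /= !map_mxD !map_mxM !map_trmx !addrA.
Qed.

(** Each summand is monic of degree n.  Positive leading coefficients make the
    polynomials eventually positive, as the interlacing argument requires. *)
Lemma sumpoly_lead l A : (size (sumpoly l A) <= n.+1)%N /\ 0 < (sumpoly l A)`_n.
Proof.
elim: l A => [|e l IHl] A.
  have -> : sumpoly [::] A = char_poly (- A).
    by rewrite sumpoly_nil /char_poly /char_poly_mx map_mxN opprK.
  have := monicP (char_poly_monic (- A)).
  by rewrite lead_coefE size_char_poly => ->.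
have [s0 c0] := IHl (A + (r e false)^T *m r e false).
have [s1 c1] := IHl (A + (r e true)^T *m r e true).
rewrite sumpoly_cons coefD addr_gt0 //; split=> //.
by rewrite (leq_trans (size_polyD _ _)) // geq_max s0.
Qed.

Lemma coef_lead_gt0 (f : {poly R}) : (size f <= n.+1)%N -> 0 < f`_n -> 0 < lead_coef f.
Proof.
move=> sf cf; have : (n < size f)%N.
  by rewrite ltnNge; apply/negP => /leq_sizeP/(_ _ (leqnn _)) E; rewrite E ltxx in cf.
by rewrite lead_coefE; case: (size f) sf => // k kn nk; rewrite (@anti_leq k n) // -ltnS kn.
Qed.

Lemma upper_half_sym A (z : R[i]) : A^T = A -> 0 < 'Im z ->
  upper_half (z%:M + map_mx (real_complex R) A).
Proof.
move=> Asym z0 x x0; rewrite mulmxDr mulmxDl mxE raddfD /= mul_mx_scalar -scalemxAl mxE.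
rewrite (hermitian_form_real x (M := map_mx (real_complex R) A)); last first.
  apply/matrixP => i j; rewrite !mxE -[in RHS]Asym mxE.
  by apply/CrealP/complex_realP; exists (A j i).
have x2 : 0 < (x *m x^t*) 0 0 by rewrite -dotmxE dotmx_is_dotmx.
by rewrite addr0 ImMr ?gtr0_real // mulr_gt0.
Qed.

Lemma sumpoly_root l A (z : R[i]) :
  (map_poly (real_complex R) (sumpoly l A)).[z] =
  sumdet (fun e b => map_mx (real_complex R) (r e b)) l
         (z%:M + map_mx (real_complex R) A).
Proof.
pose f : {rmorphism _ -> _} := horner_eval z \o map_poly (real_complex R).
rewrite -[LHS]/(f _) map_sumdet map_mxD map_scalar_mx /= map_polyX horner_evalE hornerX.
have fC m (B : 'M[R]_(m, n)) : map_mx f (map_mx polyC B) = map_mx (real_complex R) B.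
  by apply/matrixP => i j; rewrite !mxE /= map_polyC horner_evalE hornerC.
by rewrite fC; apply: eq_sumdet => e b; exact: fC.
Qed.

(** Evaluated at z with Im z > 0, the combination is the value of a stable
    functional at z + A, which lies in the upper half space. *)
Lemma sumpoly_mix_real_rooted l A0 A1 (s0 s1 : 'rV[R]_n) A p q :
  A^T = A -> A0 = A + s0^T *m s0 -> A1 = A + s1^T *m s1 ->
  0 <= p -> 0 <= q -> 0 < p + q ->
  real_rooted (p *: sumpoly l A0 + q *: sumpoly l A1).
Proof.
move=> Asym -> -> p0 q0 pq; apply: real_rooted_halfplane => [|z z0].
  have [_ c0] := sumpoly_lead l (A + s0^T *m s0).
  have [_ c1] := sumpoly_lead l (A + s1^T *m s1).
  apply/eqP => /(congr1 (fun f : {poly R} => f`_n)); rewrite coefD !coefZ coef0 => /eqP.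
  apply/negP; rewrite gt_eqF //; move: p0; rewrite le_eqVlt => /predU1P[p0|p0].
    by move: pq; rewrite -p0 mul0r !add0r => q1; rewrite mulr_gt0.
  by rewrite ltr_pwDl ?mulr_gt0 // mulr_ge0 // ltW.
have realr m (B : 'rV[R]_m) : map_mx (real_complex R) B \is a realmx.
  by apply/mxOverP => i j; rewrite mxE; apply/complex_realP; exists (B i j).
have [|||_ nz] := @stable_mix _ _ _ _ _ p%:C%C q%:C%C (realr _ s0) (realr _ s1) _ _ _
   (stable_sumdet l (fun e b => realr _ (r e b))).
- by rewrite ler0c.
- by rewrite ler0c.
- by rewrite -rmorphD ltcR.
rewrite /root rmorphD /= !map_polyZ hornerD !hornerZ !sumpoly_root !map_mxD !map_mxM.
by rewrite -!map_trmx !addrA; apply/nz/upper_half_sym.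
Qed.

(** The method of interlacing families: by [common_interlacing] one of the two
    vectors of the first edge keeps the remaining sum positive beyond mu. *)
Theorem interlacing_selection l A mu : uniq l -> A^T = A ->
  pos_above mu (sumpoly l A) ->
  exists s : I -> bool, pos_above mu
    (\det ('X%:M + map_mx polyC (A + \sum_(e <- l) (r e (s e))^T *m r e (s e)))).
Proof.
elim: l A => [|e l IHl] A /=.
  by move=> _ _ pos; exists (fun=> true); rewrite big_nil addr0.
move=> /andP[el ul] Asym; rewrite sumpoly_cons => pos.
pose A' b := A + (r e b)^T *m r e b.
have [b posb] : exists b, pos_above mu (sumpoly l (A' b)).
  have [s0 c0] := sumpoly_lead l (A' false).
  have [s1 c1] := sumpoly_lead l (A' true).
  have rr p q : 0 <= p -> 0 <= q -> 0 < p + q ->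
      real_rooted (p *: sumpoly l (A' false) + q *: sumpoly l (A' true)).
    by move=> *; apply: (sumpoly_mix_real_rooted _ Asym).
  have [] := common_interlacing (coef_lead_gt0 s0 c0) (coef_lead_gt0 s1 c1) rr pos.
    by exists false.
  by exists true.
have [|s sP] := IHl (A' b) ul _ posb.
  by rewrite /A' linearD /= Asym trmx_mul trmxK.
exists (fun x => if x == e then b else s x).
rewrite big_cons eqxx addrA (_ : \sum_(_ <- l) _ = \sum_(x <- l) (r x (s x))^T *m r x (s x)) //.
by rewrite !big_seq; apply: eq_bigr => x xl; case: eqP xl el => // -> ->.
Qed.

End Selection.

(** * Minors of matrices masked by an index set *)

Section Minors.
Variables (K : comNzRingType) (n : nat).
Implicit Types (M N : 'M[K]_n) (S : {set 'I_n}).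

Lemma eq_cofactor M N v w :
  (forall i j, i != v -> j != w -> M i j = N i j) -> cofactor M v w = cofactor N v w.
Proof.
move=> MN; rewrite /cofactor; congr (_ * \det _).
by apply/matrixP => i j; rewrite !mxE MN // eq_sym neq_lift.
Qed.

Lemma det_row_delta M v w :
  (forall j, M v j = (j == w)%:R) -> \det M = cofactor M v w.
Proof.
move=> Mv; rewrite (expand_det_row _ v) (bigD1 w) //= Mv eqxx mul1r.
by rewrite big1 ?addr0 // => j jw; rewrite Mv (negPf jw) mul0r.
Qed.

Lemma det_col_delta M v w :
  (forall i, M i w = (i == v)%:R) -> \det M = cofactor M v w.
Proof.
move=> Mv; rewrite (expand_det_col _ w) (bigD1 v) //= Mv eqxx mul1r.
by rewrite big1 ?addr0 // => j jw; rewrite Mv (negPf jw) mul0r.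
Qed.

(** Replacing the rows and columns outside S by those of the identity gives a
    matrix with the determinant of the submatrix on S while keeping its size,
    so that minors for all S live in one type. *)
Definition mask S M : 'M[K]_n :=
  \matrix_(i, j) if (i \in S) && (j \in S) then M i j else (i == j)%:R.

Lemma cofactor_mask S M v : v \in S -> cofactor (mask S M) v v = \det (mask (S :\ v) M).
Proof.
move=> vS; rewrite (@det_row_delta _ v v); last first.
  by move=> j; rewrite !mxE !inE eqxx /= eq_sym.
by apply: eq_cofactor => i j iv jv; rewrite !mxE !inE iv jv.
Qed.

Definition row_delta v w M : 'M[K]_n := \matrix_(i, j) if i == v then (j == w)%:R else M i j.
Definition col_delta v w M : 'M[K]_n := \matrix_(i, j) if j == w then (i == v)%:R else M i j.

Lemma cofactor_row_delta M v w : cofactor M v w = \det (row_delta v w M).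
Proof.
rewrite (@det_row_delta _ v w); last by move=> j; rewrite mxE eqxx.
by apply: eq_cofactor => i j iv jw; rewrite mxE (negPf iv).
Qed.

Lemma cofactor_col_delta M v w : cofactor M v w = \det (col_delta v w M).
Proof.
rewrite (@det_col_delta _ v w); last by move=> j; rewrite mxE eqxx.
by apply: eq_cofactor => i j iv jw; rewrite mxE (negPf jw).
Qed.

(** With row v replaced by the unit row at w, and then column v by the unit
    column at w, exchanging rows v and w leads to the matrix masked by S minus
    {v, w}; the exchange is the source of the sign. *)
Lemma cofactor2_mask S M v w : v \in S -> w \in S -> w != v ->
  cofactor (row_delta v w (mask S M)) w v = - \det (mask (S :\ v :\ w) M).
Proof.
move=> vS wS wv; rewrite cofactor_col_delta; set N := col_delta _ _ _.
have -> : \det N = - \det (xrow v w N).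
  by rewrite xrowE det_mulmx det_perm odd_tperm eq_sym wv expr1 mulN1r opprK.
congr (- _).
rewrite (@det_row_delta _ w w); last first.
  move=> j; rewrite !mxE tpermR eqxx [v == w]eq_sym (negPf wv).
  by case: eqP => // ->; rewrite eq_sym (negPf wv).
rewrite cofactor_col_delta (@det_col_delta _ v v); last first.
  move=> i; rewrite !mxE eq_sym (negPf wv) eqxx; case: tpermP => [->|->|].
  - by rewrite !eqxx.
  - by rewrite eq_sym.
  by move=> /eqP/negPf -> /eqP/negPf ->.
rewrite [RHS](@det_col_delta _ v v); last first.
  by move=> i; rewrite !mxE !inE eqxx !(andbF, andFb).
apply: eq_cofactor => i j iv jv; rewrite !mxE !inE iv (negPf jv) /=.
case: (eqVneq j w) => [->|jw]; first by rewrite !andbF.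
case: tpermP iv => [->|->|/eqP/negPf iv /eqP/negPf iw _]; rewrite ?(negPf wv) ?eqxx //=.
  by rewrite eq_sym (negPf jw).
by rewrite iv iw.
Qed.

End Minors.

(** * Averages over signings and the matching recursion *)

Section Flip.
Variable I : finType.
Implicit Type s : {ffun I -> bool}.

Definition flip (f : I) s : {ffun I -> bool} := [ffun g => s g (+) (g == f)].

Lemma flipK f : involutive (flip f).
Proof. by move=> s; apply/ffunP => g; rewrite !ffunE addbK. Qed.

Lemma sum_flip (V : nmodType) f (F : {ffun I -> bool} -> V) :
  \sum_s F s = \sum_s F (flip f s).
Proof. exact: (reindex_inj (inv_inj (flipK f))). Qed.

Lemma sum_flip_odd (R : numDomainType) f (F : {ffun I -> bool} -> R) :
  (forall s, F (flip f s) = - F s) -> \sum_s F s = 0.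
Proof.
move=> Ff; have : \sum_s F s = - \sum_s F s.
  by rewrite {1}(sum_flip f) -sumrN; apply: eq_bigr => s _.
by move/eqP; rewrite -addr_eq0 -mulr2n -mulr_natl mulf_eq0 pnatr_eq0 => /eqP.
Qed.

End Flip.

Section MatchingRecursion.
Variables (R : realFieldType) (n : nat) (e : rel 'I_n).
Hypothesis e_sym : symmetric e.
Hypothesis e_irr : irreflexive e.
Implicit Types (s : {ffun {set 'I_n} -> bool}) (S : {set 'I_n}).

(** A sign is attached to a set of two vertices, which makes the matrix
    symmetric for symmetric e. *)
Definition signed_adj (s : {set 'I_n} -> bool) : 'M[R]_n :=
  \matrix_(i, j) if e i j then (-1) ^+ s [set i; j] else 0.

Lemma signed_adj_flip f s i j :
  signed_adj (flip f s) i j = (-1) ^+ ([set i; j] == f) * signed_adj s i j.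
Proof.
by rewrite !mxE ffunE; case: ifP => _; rewrite ?mulr0 // signr_addb mulrC.
Qed.

Lemma eq_set2l (v i w : 'I_n) : ([set v; i] == [set v; w]) = (i == w).
Proof.
apply/eqP/eqP => [E|->//].
have := set22 v i; rewrite E !inE => /predU1P[iv|/eqP //].
by have := set22 v w; rewrite -E !inE iv orbb => /eqP.
Qed.

(** Up to the number of signings, the matching polynomial at x of the graph
    induced on S. *)
Definition signed_sum (x : R) S : R :=
  \sum_(s : {ffun {set 'I_n} -> bool}) \det (mask S (x%:M - signed_adj s)).

(** Expanding along row v and then along column v gives products
    a_vw a_iv times a cofactor in which the signs of the edges at v do not
    occur.  Changing the sign of the edge vw shows that such a term sums to 0
    unless i = w, and then a_vw^2 = 1. *)
Lemma signed_sum_rec x S v : v \in S ->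
  signed_sum x S = x * signed_sum x (S :\ v)
                 - \sum_(w in S :\ v | e v w) signed_sum x (S :\ v :\ w).
Proof.
move=> vS; rewrite /signed_sum.
pose N s := mask S (x%:M - signed_adj s).
have rowE s : \det (N s) = x * \det (mask (S :\ v) (x%:M - signed_adj s))
    - \sum_(w in S :\ v | e v w) signed_adj s v w * cofactor (N s) v w.
  rewrite (expand_det_row _ v) (bigD1 v) //= cofactor_mask //; congr (_ + _).
    by rewrite !mxE vS eqxx e_irr subr0 mulr1n.
  rewrite -sumrN [RHS]big_mkcondl /= [RHS]big_mkcond [LHS]big_mkcond /=.
  apply: eq_bigr => w _; rewrite !mxE !inE vS /= [v == w]eq_sym.
  case: (eqVneq w v) => [->|wv]; first by rewrite e_irr.
  case: (w \in S); case: (e v w); rewrite ?mulr0n ?sub0r ?mulNr ?mul0r ?oppr0 //.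
have cofE s w : w \in S -> w != v -> cofactor (N s) v w =
    signed_adj s v w * \det (mask (S :\ v :\ w) (x%:M - signed_adj s))
    - \sum_(i in S | (i != v) && (i != w))
        signed_adj s i v * cofactor (row_delta v w (N s)) i v.
  move=> wS wv; rewrite cofactor_row_delta (expand_det_col _ v) (bigD1 v) //=.
  rewrite (bigD1 w) //= cofactor2_mask // [X in X * _]mxE eqxx eq_sym (negPf wv).
  rewrite mul0r add0r; congr (_ + _).
    rewrite !mxE (negPf wv) wS vS /= mulr0n sub0r mulrNN e_sym.
    by rewrite [[set w; v]]setUC.
  rewrite -sumrN [RHS]big_mkcondl [RHS]big_mkcond [LHS]big_mkcond /=.
  apply: eq_bigr => i _; rewrite [in X in X * _]mxE.
  case: (eqVneq i v) => [_|iv] /=; first by [].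
  case: (eqVneq i w) => [_|iw] /=; first by [].

  rewrite [in X in X * _]mxE vS andbT (negPf iv).
  by case: (i \in S); rewrite ?mul0r // !mxE (negPf iv) mulr0n sub0r mulNr.
(* The cofactor involves only entries off row v and column v, so that changing
   the sign of the edge vw leaves it unchanged. *)
have cross s w i : i != v -> i != w ->
    signed_adj (flip [set v; w] s) v w *
      (signed_adj (flip [set v; w] s) i v
        * cofactor (row_delta v w (N (flip [set v; w] s))) i v)
  = - (signed_adj s v w * (signed_adj s i v * cofactor (row_delta v w (N s)) i v)).
  move=> iv iw; rewrite !signed_adj_flip eqxx [[set i; v]]setUC eq_set2l (negPf iw).
  rewrite expr1 mulN1r expr0 mul1r mulNr; congr (- (_ * (_ * _))).
  apply: eq_cofactor => k j ki jv; rewrite !mxE; case: (eqVneq k v) => // kv.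
  rewrite ffunE (_ : ([set k; j] == _) = false) ?addbF //; apply/eqP => E.
  by move: (set21 v w); rewrite -E !inE eq_sym (negPf kv) eq_sym (negPf jv).
under eq_bigr => s _ do rewrite -/(N s) rowE.
rewrite big_split /= -mulr_sumr sumrN [X in _ - X = _]exchange_big /=; congr (_ - _).
apply: eq_bigr => w /andP[/setD1P[wv wS] vw].
under eq_bigr => s _ do rewrite cofE // mulrBr mulrA.
rewrite big_split /= [X in _ + X](_ : _ = 0) ?addr0.
  apply: eq_bigr => s _; rewrite !mxE vw.
  by rewrite -expr2 sqrr_sign mul1r.
under eq_bigr => s _ do rewrite mulr_sumr.
rewrite sumrN exchange_big big1 ?oppr0 // => i /andP[_ /andP[iv iw]].
by apply: (sum_flip_odd (f := [set v; w])) => s; rewrite cross.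
Qed.

Lemma signed_sum0 x : 0 < signed_sum x set0.
Proof.
rewrite /signed_sum (eq_bigr (fun=> 1)) => [|s _].
  by rewrite sumr_const card_ffun card_bool ltr0n expn_gt0.
by rewrite -[RHS](det1 R n); congr (\det _); apply/matrixP => i j; rewrite !mxE !inE.
Qed.

(** The bound of Heilmann and Lieb, with t = sqrt d, by induction on the size
    of S; write P for signed_sum x.  A neighbour w of v has at most d
    neighbours in S minus v, so that P (S - v) >= t * P (S - v - w).  The
    recursion then gives P S >= (x - deg v / t) * P (S - v), where the factor is
    at least t if deg v <= d, and positive if deg v <= d + 1. *)
Theorem signed_sum_bound x t d : 1 <= t -> t ^+ 2 = d%:R -> 2 * t < x ->
  (forall v, #|[set w | e v w]| <= d.+1)%N ->
  forall S, 0 < signed_sum x S /\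
    forall v, v \in S -> (#|[set w in S | e v w]| <= d)%N ->
      t * signed_sum x (S :\ v) <= signed_sum x S.
Proof.
move=> t1 t2 tx deg S; have [k] := ubnP #|S|; elim: k S => // k IHk S Sk.
have step v : v \in S -> 0 < signed_sum x (S :\ v) /\
    (t * x - #|[set w in S | e v w]|%:R) * signed_sum x (S :\ v) <= t * signed_sum x S.
  move=> vS; have [|pos IH] := IHk (S :\ v).
    by rewrite -ltnS (leq_trans _ Sk) // ltnS [#|S|](cardsD1 v) vS.
  split=> //; rewrite (signed_sum_rec _ vS) mulrBr mulrBl mulrA lerD2l lerN2.
  rewrite mulr_sumr mulr_natl -sumr_const (eq_bigl (mem [set w in S | e v w])) /=.
    apply: ler_sum => w; rewrite inE => /andP[wS vw].
    have wSv : w \in S :\ v.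
      by rewrite !inE wS andbT; apply: contraTneq vw => ->; rewrite e_irr.
    apply: IH => //; rewrite -ltnS (leq_trans _ (deg w)) //.
    apply: proper_card; apply/properP; split.
      by apply/subsetP => y; rewrite !inE => /andP[].
    by exists v; rewrite !inE ?eqxx // e_sym.
  move=> w; rewrite !inE; case: (eqVneq w v) => [->|] //=.
  by rewrite e_irr !andbF.
have deg_S v : (#|[set w in S | e v w]| <= d.+1)%N.
  rewrite (leq_trans _ (deg v)) // subset_leq_card //.
  by apply/subsetP => y; rewrite !inE => /andP[].
have t0 : 0 < t by lra.
split.
  have [->|[v vS]] := set_0Vmem S; first exact: signed_sum0.
  have [pos le_S] := step v vS; rewrite -(pmulr_rgt0 _ t0) (lt_le_trans _ le_S) //.
  rewrite mulr_gt0 // subr_gt0 (@le_lt_trans _ _ (t ^+ 2 + 1)) //; last by nra.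
  by rewrite t2 natr1 ler_nat.
move=> v vS dv; have [pos le_S] := step v vS; rewrite -(ler_pM2l t0).
apply: le_trans le_S; rewrite mulrA ler_pM2r // lerBrDr.
apply: (@le_trans _ _ (t * t + t ^+ 2)); last by nra.
by rewrite lerD2l t2 ler_nat.
Qed.

End MatchingRecursion.

(** * Quadratic forms of real symmetric matrices *)

Section Symmetric.
Variables (R : rcfType) (n : nat).
Implicit Types (A : 'M[R]_n) (x y : 'rV[R]_n).

Local Notation toC := (map_mx (real_complex R)).

Definition qform A x : R := (x *m A *m x^T) 0 0.

Lemma map_mx_real m p (B : 'M[R]_(m, p)) : toC B \is a realmx.
Proof. by apply/mxOverP => i j; rewrite mxE; apply/complex_realP; exists (B i j). Qed.

(** The spectral theorem, with a complex unitary matrix and real eigenvalues: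
    complex eigenvectors suffice because only the squared moduli of the
    coordinates enter below. *)
Lemma spectral_sym A : A^T = A -> exists (P : 'M[R[i]]_n) (d : 'rV[R]_n),
  P \is unitarymx /\ toC A = P^t* *m diag_mx (toC d) *m P.
Proof.
move=> Asym; pose P := spectralmx (toC A).
have hA : toC A \is hermsymmx.
  apply: realsym_hermsym (map_mx_real A); apply/is_hermitianmxP.
  by rewrite expr0 scale1r map_mx_id // map_trmx Asym.
have Pu : P \is unitarymx by exact: spectral_unitarymx.
have dr := hermitian_spectral_diag_real hA.
exists P, (map_mx (@complex.Re R) (spectral_diag (toC A))); split=> //.
have -> : toC (map_mx (@complex.Re R) (spectral_diag (toC A))) = spectral_diag (toC A).
  by apply/rowP => j; rewrite mxE mxE RRe_real //; move/mxOverP: dr; apply.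
by rewrite -invmx_unitary //; apply/orthomx_spectralP/hermitian_normalmx.
Qed.

Lemma char_poly_diag A (P : 'M[R[i]]_n) (d : 'rV[R]_n) :
  P \is unitarymx -> toC A = P^t* *m diag_mx (toC d) *m P ->
  char_poly A = \prod_(z <- [seq d 0 i | i <- enum 'I_n]) ('X - z%:P).
Proof.
move=> Pu AE; apply: (map_poly_inj (real_complex R)).
rewrite map_char_poly AE rmorph_prod big_map big_enum /=.
pose Q := map_mx polyC P; pose Q' := map_mx polyC (P^t*).
have QQ : Q' *m Q = 1%:M.
  by rewrite -map_mxM -invmx_unitary // mulVmx ?unitarymx_unit // map_mx1.
rewrite /char_poly /char_poly_mx !map_mxM -/Q -/Q'.
have -> : 'X%:M = Q' *m 'X%:M *m Q by rewrite mul_mx_scalar -scalemxAl QQ scalemx1.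
rewrite -mulmxBl -mulmxBr !det_mulmx mulrAC -det_mulmx QQ det1 mul1r.
rewrite map_diag_mx -diag_const_mx -linearB /= det_diag.
by apply: eq_bigr => i _; rewrite !mxE rmorphB /= map_polyX map_polyC.
Qed.

Lemma qform_diag A (P : 'M[R[i]]_n) (d : 'rV[R]_n) (y : 'rV[R[i]]_n) :
  P \is unitarymx -> toC A = P^t* *m diag_mx (toC d) *m P ->
  (y *m P *m toC A *m (y *m P)^t*) 0 0 = \sum_i (d 0 i)%:C%C * `|y 0 i| ^+ 2.
Proof.
move=> Pu ->; rewrite trmx_mul map_mxM !mulmxA mulmxtVK // mulmxtVK // mxE.
apply: eq_bigr => i _; rewrite mul_mx_diag !mxE normCK.
by rewrite mulrAC mulrC.
Qed.

Lemma sqnorm_unitary (P : 'M[R[i]]_n) (y : 'rV[R[i]]_n) : P \is unitarymx ->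
  (y *m P *m (y *m P)^t*) 0 0 = \sum_i `|y 0 i| ^+ 2.
Proof.
move=> Pu; rewrite trmx_mul map_mxM !mulmxA mulmxtVK // mxE.
by apply: eq_bigr => i _; rewrite !mxE normCK.
Qed.

Lemma toC_conj m p (B : 'M[R]_(m, p)) : (toC B)^t* = toC B^T.
Proof.
by apply/matrixP => i j; rewrite !mxE; apply/CrealP/complex_realP; exists (B j i).
Qed.

Theorem char_poly_qform A mu x : A^T = A ->
  (forall z, mu < z -> (char_poly A).[z] != 0) ->
  qform A x <= mu * (x *m x^T) 0 0.
Proof.
move=> Asym nz; have [P [d [Pu AE]]] := spectral_sym Asym.
have dmu i : d 0 i <= mu.
  rewrite leNgt; apply/negP => /nz/eqP; apply; apply/rootP.
  by rewrite (char_poly_diag Pu AE) root_prod_XsubC map_f // mem_enum.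
pose y := toC x *m P^t*.
have yP : y *m P = toC x by rewrite /y -invmx_unitary // mulmxKV // unitarymx_unit.
have qE : (qform A x)%:C%C = \sum_i (d 0 i)%:C%C * `|y 0 i| ^+ 2.
  by rewrite -(qform_diag y Pu AE) yP toC_conj -!map_mxM [RHS]mxE.
have nE : ((x *m x^T) 0 0)%:C%C = \sum_i `|y 0 i| ^+ 2.
  by rewrite -(sqnorm_unitary y Pu) yP toC_conj -!map_mxM [RHS]mxE.
rewrite -lecR rmorphM /= qE nE mulr_sumr; apply: ler_sum => i _.
by rewrite ler_wpM2r ?exprn_ge0 // lecR.
Qed.

(** The mixed terms cancel because A is symmetric: a bound for the form on real
    vectors carries over to complex ones. *)
Lemma qform_toC A (a b : 'rV[R]_n) : A^T = A ->
  let y := toC a + 'i *: toC b in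
  (y *m toC A *m y^t*) 0 0 = (qform A a + qform A b)%:C%C.
Proof.
move=> Asym /=; have cr (z : R) : (z%:C%C)^* = z%:C%C.
  by apply/CrealP/complex_realP; exists z.
have -> : (toC a + 'i *: toC b)^t* = toC a^T - 'i *: toC b^T.
  apply/matrixP => i j; rewrite !mxE rmorphD rmorphM /= conjCi -/(_%:C%C) -/(_%:C%C).
  by rewrite !cr mulNr.
have ba : b *m A *m a^T = a *m A *m b^T.
  have <- : (b *m A *m a^T)^T = a *m A *m b^T by rewrite !trmx_mul trmxK Asym mulmxA.
  by apply/matrixP => i j; rewrite !mxE !ord1.
rewrite mulmxDl -!scalemxAl mulmxDl !mulmxBr -!scalemxAl -!scalemxAr -!map_mxM ba.
rewrite scalerA -expr2 sqrCi scaleN1r opprK addrA subrK -map_mxD mxE.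
by congr (_%:C%C); rewrite mxE.
Qed.

(** Two eigenvectors with eigenvalues beyond c span a plane, which contains a
    nonzero vector orthogonal to w; on it the form would exceed c times the
    squared norm. *)
Lemma qform_one_large A (w : 'cV[R]_n) c (d : 'rV[R]_n) P :
  A^T = A -> P \is unitarymx -> toC A = P^t* *m diag_mx (toC d) *m P ->
  (forall x, x *m w = 0 -> qform A x <= c * (x *m x^T) 0 0) ->
  forall i j, c < d 0 i -> c < d 0 j -> i = j.
Proof.
move=> Asym Pu AE small i j ci cj; apply/eqP; apply: contraT => ij.
have [u uE] : exists u, u = P *m toC w by exists (P *m toC w).
(* The combination al P_i + be P_j of rows of P is orthogonal to w.  If both
   rows already are, the general formula would give al = be = 0. *)
pose al := if (u i 0 == 0) && (u j 0 == 0) then 1 else u j 0.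
pose be := if (u i 0 == 0) && (u j 0 == 0) then 0 else - u i 0.
pose z : 'rV[R[i]]_n := al *: delta_mx 0 i + be *: delta_mx 0 j.
have zu : z *m P *m toC w = 0.
  apply/rowP => k; rewrite -mulmxA -uE ord1 /z mulmxDl -!scalemxAl -!rowE !mxE /al /be.
  case: (eqVneq (u i 0) 0) => [->|_]; case: (eqVneq (u j 0) 0) => [->|_] /=;
    rewrite ?(mulr0, mul0r, addr0, oppr0) //.
  by rewrite mulNr mulrC subrr.
have zE k : z 0 k = if k == i then al else if k == j then be else 0.
  rewrite !mxE eqxx /=; case: (eqVneq k i) => [->|ki].
    by rewrite (negPf ij) mulr1 mulr0 addr0.
  by rewrite mulr0 add0r; case: eqP => _; rewrite ?mulr1 ?mulr0.
pose a := map_mx (@complex.Re R) (z *m P); pose b := map_mx (@complex.Im R) (z *m P).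
have yE : z *m P = toC a + 'i *: toC b.
  by apply/rowP => k; rewrite !mxE; exact: complexE.
have [aw bw] : a *m w = 0 /\ b *m w = 0.
  have split0 (s t : R) : s%:C%C + 'i * t%:C%C = 0 -> s = 0 /\ t = 0.
    move=> E; have := congr1 (@complex.Re R) E; have := congr1 (@complex.Im R) E => /=.
    by rewrite !(mul0r, mul1r, mulr0, addr0, add0r, subr0).
  move: zu; rewrite yE mulmxDl -scalemxAl -!map_mxM.
  move: (a *m w) (b *m w) => s t /matrixP st.
  by split; apply/matrixP => k l; move: (st k l); rewrite !mxE => /split0[].
have small_sum : qform A a + qform A b <= c * ((a *m a^T) 0 0 + (b *m b^T) 0 0).
  by rewrite mulrDr lerD // small.
have : (qform A a + qform A b)%:C%C <= (c * ((a *m a^T) 0 0 + (b *m b^T) 0 0))%:C%C.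
  by rewrite lecR.
rewrite rmorphM /= -qform_toC // -yE (qform_diag z Pu AE).
have -> : ((a *m a^T) 0 0 + (b *m b^T) 0 0)%:C%C = \sum_k `|z 0 k| ^+ 2.
  have := @qform_toC 1%:M a b (trmx1 _ _).
  by rewrite /= map_mx1 mulmx1 -yE (sqnorm_unitary z Pu) /qform !mulmx1.
rewrite mulr_sumr -subr_ge0 -sumrB (bigD1 i) //= (bigD1 j) ?[j == i]eq_sym //=.
rewrite [X in _ + (_ + X)]big1 ?addr0 => [|k /andP[ki kj]]; last first.
  by rewrite zE (negPf ki) (negPf kj) normr0 expr0n !mulr0 subr0.
rewrite !zE eqxx [j == i]eq_sym (negPf ij) eqxx -!mulrBl -!rmorphB /=.
have neg k : c < d 0 k -> (c - d 0 k)%:C%C < 0 :> R[i] by rewrite ltcR subr_lt0.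
apply: contraTT => _; rewrite -real_ltNge ?real0 //; last first.
  by rewrite rpredD // rpredM ?rpredX ?normr_real //; apply/complex_realP; eexists.
rewrite /al /be; case: ifP => uij.
  by rewrite normr0 normr1 expr1n expr0n mulr0 addr0 mulr1 neg.
have sq_le0 (v : R[i]) k : c < d 0 k -> (c - d 0 k)%:C%C * `|v| ^+ 2 <= 0.
  by move=> /neg/ltW h; rewrite mulr_le0_ge0 // exprn_ge0.
have sq_lt0 (v : R[i]) k : v != 0 -> c < d 0 k -> (c - d 0 k)%:C%C * `|v| ^+ 2 < 0.
  by move=> v0 /neg h; rewrite pmulr_llt0 // exprn_gt0 // normr_gt0.
move/negbT: uij; rewrite negb_and => /orP[ui|uj].
  by rewrite ltr_wnDl ?sq_le0 // sq_lt0 // oppr_eq0.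
by rewrite ltr_wnDr ?sq_le0 // sq_lt0.
Qed.

End Symmetric.

(** * The list of roots of a split polynomial *)

Section RootList.
Variable R : rcfType.
Implicit Types (p : {poly R}) (s : seq R).

Definition root_list p : seq R := flatten [seq nseq (mup x p) x | x <- rootsR p].

Lemma root_list_sorted p : sorted <=%R (root_list p).
Proof.
rewrite /root_list; move: (sorted_roots (- cauchy_bound p) (cauchy_bound p) p).
rewrite -/(rootsR p) (sorted_pairwise lt_trans) (sorted_pairwise le_trans).
elim: (rootsR p) => //= x r IHr /andP[/allP xr /IHr pr].
rewrite pairwise_cat pr andbT; apply/andP; split.
  apply/allrelP => y z /nseqP[-> _] /flatten_mapP[w /xr xw /nseqP[-> _]].
  exact: ltW.
by elim: (mup x p) => //= m IHm; rewrite IHm andbT; apply/allP => y /nseqP[->].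
Qed.

Lemma root_list_prod s : perm_eq (root_list (\prod_(z <- s) ('X - z%:P))) s.
Proof.
set p := \prod_(z <- s) _; have p0 : p != 0 by rewrite monic_neq0 ?monic_prod_XsubC.
have rootsE x : (x \in rootsR p) = (x \in s).
  by rewrite -roots_on_rootsR // inE /= root_prod_XsubC.
apply/allP => y _ /=; apply/eqP; rewrite /root_list count_flatten -map_comp sumnE big_map.
rewrite (eq_bigr (fun x => if x == y then count_mem y s else 0)%N) => [|x _]; last first.
  rewrite /= count_nseq mu_prod_XsubC /=.
  by case: eqP => [->|]; rewrite ?mul1n ?mul0n.
have ur : uniq (rootsR p) by rewrite /rootsR uniq_roots.
rewrite -big_mkcond /=; have [ys|ys] := boolP (y \in s).
  by rewrite -big_filter filter_pred1_uniq ?rootsE // big_seq1.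
by rewrite big1_seq ?(count_memPn ys) // => x /andP[/eqP->]; rewrite rootsE (negPf ys).
Qed.

End RootList.

(** * Signings with small eigenvalues *)

Section SumOverChoices.
Variables (R : realType) (n : nat) (I : finType) (r : I -> bool -> 'rV[R]_n).
Implicit Types (A : 'M[R]_n) (l : seq I).

Definition choice_poly l A (s : I -> bool) : {poly R} :=
  \det ('X%:M + map_mx polyC (A + \sum_(e <- l) (r e (s e))^T *m r e (s e))).

(** A choice on l is the restriction of #|{ffun I -> bool}| / 2 ^ size l
    functions on I, which explains the two factors. *)
Lemma sumpoly_choices l A : uniq l ->
  (\sum_(s : {ffun I -> bool}) choice_poly l A s) *+ 2 ^ size l
    = sumpoly r l A *+ #|{ffun I -> bool}|.
Proof.
elim: l A => [|e l IHl] A /=.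
  move=> _; rewrite mulr1n sumpoly_nil -sumr_const.
  by apply: eq_bigr => s _; rewrite /choice_poly big_nil addr0.
move=> /andP[el ul].
pose h b (s : {ffun I -> bool}) := choice_poly l (A + (r e b)^T *m r e b) s.
have chE (s : {ffun I -> bool}) : choice_poly (e :: l) A s = h (s e) s.
  by rewrite /choice_poly big_cons addrA.
have h_flip b s : h b (flip e s) = h b s.
  rewrite /h /choice_poly; congr (\det ('X%:M + map_mx _ (_ + _))).
  rewrite !big_seq; apply: eq_bigr => x xl; rewrite ffunE.
  by case: eqP xl el => [->->|_ _ _] //; rewrite addbF.
have two : (\sum_(s : {ffun I -> bool}) choice_poly (e :: l) A s) *+ 2 =
    \sum_s h false s + \sum_s h true s.
  rewrite mulr2n {2}(sum_flip e) -!big_split /=; apply: eq_bigr => s _.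
  by rewrite !chE h_flip ffunE eqxx addbT; case: (s e) => //=; rewrite addrC.
by rewrite expnS mulnC mulrnA mulrnAC two mulrnDl !IHl // sumpoly_cons -mulrnDl.
Qed.

Lemma sumpoly_enum_pos A mu :
  (forall x, mu < x -> 0 < \sum_(s : {ffun I -> bool}) (choice_poly (enum I) A s).[x]) ->
  pos_above mu (sumpoly r (enum I) A).
Proof.
move=> pos x /pos; rewrite -horner_sum => posx.
have := congr1 (fun p => p.[x]) (sumpoly_choices A (enum_uniq I)).
rewrite !hornerMn => E.
have : 0 < (sumpoly r (enum I) A).[x] *+ #|{ffun I -> bool}|.
  by rewrite -E pmulrn_lgt0 // expn_gt0.
by rewrite pmulrn_lgt0 // card_ffun expn_gt0 card_bool.
Qed.

End SumOverChoices.

Section Signing.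
Variables (R : realType) (n : nat) (e : rel 'I_n).
Hypothesis e_sym : symmetric e.
Hypothesis e_irr : irreflexive e.
Local Notation A_ s := (signed_adj R e s).

Definition is_edge (f : {set 'I_n}) := [exists i, exists j, e i j && (f == [set i; j])].

(** The vector of the edge {i, j} with i < j is delta_i - (-1)^b delta_j, whose
    rank-one square has off-diagonal entries - (-1)^b.  Sets which are not edges
    get the zero vector, so that all sets of vertices may serve as indices. *)
Definition edge_vector (f : {set 'I_n}) (b : bool) : 'rV[R]_n :=
  \row_a if is_edge f && (a \in f)
         then if [exists c in f, (a < c)%N] then 1 else - (-1) ^+ b else 0.

Lemma is_edge_set2 a b : is_edge [set a; b] = e a b.
Proof.
apply/existsP/idP => [[i /existsP[j /andP[eij /eqP E]]]|eab]; last first.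
  by exists a; apply/existsP; exists b; rewrite eab eqxx.
have /set2P[ai|aj] : a \in [set i; j] by rewrite -E set21.
  move/eqP: E; rewrite ai eq_set2l => /eqP->.
  by [].
by move/eqP: E; rewrite aj [[set i; j]]setUC eq_set2l => /eqP->; rewrite e_sym.
Qed.

Lemma is_edge_pair f a b : is_edge f -> a \in f -> b \in f -> a != b -> f = [set a; b].
Proof.
move=> /existsP[i /existsP[j /andP[_ /eqP->]]].
by rewrite !inE => /orP[]/eqP-> /orP[]/eqP->; rewrite ?eqxx // => _; rewrite setUC.
Qed.

(** The diagonal matrix of degrees: the diagonal of the square of an edge vector
    is the same for both signs. *)
Definition edge_degree : 'M[R]_n := \sum_f diag_mx (\row_a edge_vector f false 0 a ^+ 2).

Lemma sum_edge_vectors (s : {set 'I_n} -> bool) :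
  \sum_(f : {set 'I_n}) (edge_vector f (s f))^T *m edge_vector f (s f) = edge_degree - A_ s.
Proof.
apply/matrixP => a b; rewrite mxE !summxE /edge_degree.
have prod f : ((edge_vector f (s f))^T *m edge_vector f (s f)) a b =
    edge_vector f (s f) 0 a * edge_vector f (s f) 0 b.
  by rewrite mxE big_ord1 mxE.
under eq_bigr => f _ do rewrite prod.
have [<-|ab] := eqVneq a b.
  rewrite [in RHS]mxE [in RHS]mxE e_irr subr0; apply: eq_bigr => f _.
  rewrite !mxE eqxx mulr1n; case: ifP => _; last by rewrite mulr0 expr0n.
  by case: ifP => _; rewrite ?mulr1 ?expr1n // mulrNN -expr2 !sqrrN !sqrr_sign.
rewrite [X in _ = X + _]big1 ?add0r => [|f _]; last by rewrite mxE (negPf ab).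
rewrite (bigD1 [set a; b]) //= big1 ?addr0 => [|f fab]; last first.
  rewrite !mxE; have [/andP[ef af]|_] := boolP (is_edge f && (a \in f)); last by rewrite mul0r.
  have [/andP[_ bf]|_] := boolP (is_edge f && (b \in f)); last by rewrite mulr0.
  by rewrite (is_edge_pair ef af bf ab) eqxx in fab.
rewrite !mxE is_edge_set2 !inE !eqxx orbT andbT; case: ifP => [eab|]; last by rewrite mul0r oppr0.
have exa : [exists x in [set a; b], (a < x)%N] = (a < b)%N.
  apply/exists_inP/idP => [[x] /set2P[]->|ltab]; rewrite ?ltnn //.
  by exists b; rewrite ?set22.
have exb : [exists x in [set a; b], (b < x)%N] = (b < a)%N.
  apply/exists_inP/idP => [[x] /set2P[]->|ltba]; rewrite ?ltnn //.
  by exists a; rewrite ?set21.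
rewrite exa exb; case: ltngtP ab => [_ _|_ _|/val_inj->]; rewrite ?mul1r ?mulr1 //.
by rewrite eqxx.
Qed.

(** The theorem of Marcus, Spielman and Srivastava.  The selection starts from
    minus the diagonal matrix of degrees, so that the polynomial of a signing s
    is the characteristic polynomial of A_s. *)
Theorem exists_small_signing d : (0 < d)%N -> (forall v, #|[set w | e v w]| <= d.+1)%N ->
  exists s : {set 'I_n} -> bool, forall x : 'rV[R]_n,
    qform (A_ s) x <= 2 * Num.sqrt d%:R * (x *m x^T) 0 0.
Proof.
move=> d0 deg; pose mu : R := 2 * Num.sqrt d%:R; pose A : 'M[R]_n := - edge_degree.
have charE (s : {set 'I_n} -> bool) :
    choice_poly edge_vector (enum {set 'I_n}) A s = char_poly (A_ s).
  rewrite /choice_poly big_enum sum_edge_vectors /A addrA addNr add0r map_mxN.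
  by [].
have A_sym s : (A_ s)^T = A_ s.
  by apply/matrixP => i j; rewrite !mxE e_sym setUC.
have D_sym : A^T = A.
  rewrite /A linearN /edge_degree linear_sum /=; congr (- _).
  by apply: eq_bigr => f _; rewrite tr_diag_mx.
have pos : pos_above mu (sumpoly edge_vector (enum {set 'I_n}) A).
  apply: sumpoly_enum_pos => x mux.
  have t2 : Num.sqrt d%:R ^+ 2 = d%:R :> R by rewrite sqr_sqrtr.
  have t1 : 1 <= Num.sqrt d%:R :> R.
    by rewrite -(@ler_pXn2r _ 2) ?nnegrE ?sqrtr_ge0 // t2 expr1n ler1n.
  have [+ _] := signed_sum_bound e_sym e_irr t1 t2 mux deg [set: 'I_n].
  rewrite /signed_sum; congr (0 < _); apply: eq_bigr => s _; rewrite charE.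
  rewrite /char_poly -horner_evalE -det_map_mx; congr (\det _).
  apply/matrixP => i j; rewrite !mxE !inE /= horner_evalE !hornerE.
  by case: (i == j); rewrite ?mulr1n ?mulr0n !hornerE.
have [s sP] := interlacing_selection (enum_uniq _) D_sym pos.
exists s => x; apply: char_poly_qform => // z muz.
by rewrite gt_eqF // -charE; apply: sP.
Qed.

End Signing.

(** * Bipartite graphs and their 2-lifts *)

Section BipartiteForm.
Variables (R : realType) (L : finType).
Local Notation T := (L + L)%type.
Implicit Types (w : L -> L -> R) (x y : L -> R).

Definition bipartite_fun w (a b : T) : R :=
  match a, b with
  | inl u, inr v => w u v
  | inr v, inl u => w u v
  | _, _ => 0
  end.

Definition bipartite_mx w : 'M[R]_#|{: T}| :=
  \matrix_(i, j) bipartite_fun w (enum_val i) (enum_val j).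

(** Half of the quadratic form of the bipartite matrix of w at (x, y). *)
Definition biform w x y : R := \sum_u \sum_v w u v * (x u * y v).
Definition sqnorm x : R := \sum_u x u ^+ 2.

Definition left_part (z : 'rV[R]_#|{: T}|) (u : L) := z 0 (enum_rank (inl u : T)).
Definition right_part (z : 'rV[R]_#|{: T}|) (v : L) := z 0 (enum_rank (inr v : T)).

Lemma sum_rank (F : 'I_#|{: T}| -> R) :
  \sum_i F i = \sum_u F (enum_rank (inl u : T)) + \sum_v F (enum_rank (inr v : T)).
Proof.
rewrite (reindex (@enum_rank T)) /= ?big_sumType //.
exact/onW_bij/enum_rank_bij.
Qed.

Lemma qform_bipartite w z :
  qform (bipartite_mx w) z = 2 * biform w (left_part z) (right_part z).
Proof.
rewrite /qform mxE; under eq_bigr => j _ do rewrite mxE big_distrl /=.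
rewrite exchange_big /= sum_rank.
have inlE u :
    \sum_j z 0 (enum_rank (inl u : T)) * bipartite_mx w (enum_rank (inl u : T)) j * z^T j 0
    = \sum_v w u v * (left_part z u * right_part z v).
  rewrite sum_rank big1 ?add0r => [|v _]; last by rewrite !mxE !enum_rankK /= mulr0 mul0r.
  by apply: eq_bigr => v _; rewrite !mxE !enum_rankK /=; rewrite mulrAC mulrC.
have inrE v :
    \sum_j z 0 (enum_rank (inr v : T)) * bipartite_mx w (enum_rank (inr v : T)) j * z^T j 0
    = \sum_u w u v * (left_part z u * right_part z v).
  rewrite sum_rank [X in _ + X]big1 ?addr0 => [|u _]; last first.
    by rewrite !mxE !enum_rankK /= mulr0 mul0r.
  apply: eq_bigr => u _; rewrite !mxE !enum_rankK /=.
  by rewrite mulrAC mulrC [left_part _ _ * _]mulrC.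
rewrite (eq_bigr _ (fun u _ => inlE u)) (eq_bigr _ (fun v _ => inrE v)).
by rewrite [X in _ + X]exchange_big /= -/(biform _ _ _) mulr_natl mulr2n.
Qed.

Lemma sqnorm_parts z : (z *m z^T) 0 0 = sqnorm (left_part z) + sqnorm (right_part z).
Proof.
rewrite mxE sum_rank /sqnorm.
by congr (_ + _); apply: eq_bigr => u _; rewrite mxE -expr2.
Qed.

Definition join_parts x y : 'rV[R]_#|{: T}| :=
  \row_i match enum_val i with inl u => x u | inr v => y v end.

Lemma left_join x y : left_part (join_parts x y) =1 x.
Proof. by move=> u; rewrite /left_part mxE enum_rankK. Qed.

Lemma right_join x y : right_part (join_parts x y) =1 y.
Proof. by move=> u; rewrite /right_part mxE enum_rankK. Qed.

Lemma eq_biform w x x' y y' : x =1 x' -> y =1 y' -> biform w x y = biform w x' y'.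
Proof.
by move=> xx yy; apply: eq_bigr => u _; apply: eq_bigr => v _; rewrite xx yy.
Qed.

Lemma eq_sqnorm x x' : x =1 x' -> sqnorm x = sqnorm x'.
Proof. by move=> xx; apply: eq_bigr => u _; rewrite xx. Qed.

End BipartiteForm.

Definition biregular (L : finType) (d : nat) (e : L -> L -> bool) :=
  (forall u, #|[set v | e u v]| = d) /\ (forall v, #|[set u | e u v]| = d).

Section BipartiteSigning.
Variables (R : realType) (L : finType) (q : nat) (e : L -> L -> bool).
Local Notation T := (L + L)%type.

(** The lower bound for the form is the same statement with - y for y. *)
Lemma bipartite_signing : (0 < q)%N -> biregular q.+1 e ->
  exists s : L -> L -> bool, forall x y : L -> R,
    biform (fun u v => (e u v)%:R * (-1) ^+ s u v) x y
      <= Num.sqrt q%:R * (sqnorm x + sqnorm y).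
Proof.
move=> q0 [regl regr].
pose adjb (a b : T) := match a, b with
  | inl u, inr v => e u v | inr v, inl u => e u v | _, _ => false end.
pose e' : rel 'I_#|{: T}| := fun i j => adjb (enum_val i) (enum_val j).
have e'_sym : symmetric e'.
  by move=> i j; rewrite /e'; case: (enum_val i); case: (enum_val j).
have e'_irr : irreflexive e' by move=> i; rewrite /e'; case: (enum_val i).
have deg i : (#|[set j | e' i j]| <= q.+1)%N.
  rewrite -(card_imset _ enum_val_inj) /e'.
  case: (enum_val i) => u; [rewrite -(regl u)|rewrite -(regr u)].
    rewrite -(card_imset _ (@inr_inj L L)) subset_leq_card //.
    apply/subsetP => b /imsetP[j]; rewrite inE => + ->.
    by case: (enum_val j) => //= v uv; rewrite imset_f ?inE.
  rewrite -(card_imset _ (@inl_inj L L)) subset_leq_card //.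
  apply/subsetP => b /imsetP[j]; rewrite inE => + ->.
  by case: (enum_val j) => //= v uv; rewrite imset_f ?inE.
have [s sP] := exists_small_signing R e'_sym e'_irr q0 deg.
exists (fun u v => s [set enum_rank (inl u : T); enum_rank (inr v : T)]) => x y.
have := sP (join_parts x y).
set w := fun u v => _; have -> : signed_adj R e' s = bipartite_mx w.
  apply/matrixP => i j; rewrite !mxE /bipartite_fun /w.
  rewrite -{2}(enum_valK i) -{2}(enum_valK j) /e'.
  case: (enum_val i) => u; case: (enum_val j) => v //=; case: ifP => // _; rewrite ?mul1r ?mul0r //.
  by rewrite setUC.
rewrite qform_bipartite sqnorm_parts -mulrA ler_pM2l ?ltr0n //.
rewrite (eq_biform _ (left_join x y) (right_join x y)).
by rewrite (eq_sqnorm (left_join x y)) (eq_sqnorm (right_join x y)).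
Qed.

End BipartiteSigning.

Section Lift.
Variables (R : realType) (L : finType).
Implicit Types (e : L -> L -> bool) (x y : L -> R).

Definition adjf (M : finType) (e : M -> M -> bool) (u v : M) : R := (e u v)%:R.

(** For a biregular e of degree d, the quotients of the adjacency form by the
    squared norm on vectors orthogonal to the trivial eigenvectors, those for
    the eigenvalues d and - d, are at most 2 c. *)
Definition form_bound (M : finType) c (e : M -> M -> bool) := forall x y : M -> R,
  \sum_u x u = 0 -> \sum_v y v = 0 -> biform (adjf e) x y <= c * (sqnorm x + sqnorm y).

(** Over an edge uv the lift joins (u, a) to (v, b) for b = a (+) s u v. *)
Definition lift2 e (s : L -> L -> bool) (a b : L * bool) :=
  e a.1 b.1 && (a.2 (+) b.2 == s a.1 b.1).

Lemma lift2_biregular d e s : biregular d e -> biregular d (lift2 e s).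
Proof.
move=> [regl regr]; split=> -[u a].
  rewrite -(regl u) -[RHS](card_imset (f := fun v => (v, a (+) s u v))); last by move=> v v' [].
  apply: eq_card => -[v b]; rewrite !inE /lift2 /=.
  apply/andP/imsetP => [[uv /eqP E]|[v' + [-> ->]]].
    by exists v; rewrite ?inE // -E addKb.
  by rewrite inE => ->; rewrite addKb.
rewrite -(regr u) -[RHS](card_imset (f := fun v => (v, a (+) s v u))); last by move=> v v' [].
apply: eq_card => -[v b]; rewrite !inE /lift2 /=.
apply/andP/imsetP => [[uv /eqP E]|[v' + [-> ->]]].
  by exists v; rewrite ?inE // -E addbC addbK.
by rewrite inE => ->; rewrite addbAC addbb.
Qed.

Definition even_part (z : L * bool -> R) u := (z (u, false) + z (u, true)) / 2.
Definition odd_part (z : L * bool -> R) u := (z (u, false) - z (u, true)) / 2.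

Lemma sum_pairb (F : L * bool -> R) : \sum_a F a = \sum_u (F (u, false) + F (u, true)).
Proof.
rewrite (eq_bigr (fun a => F (a.1, a.2))) => [|[]//].
by rewrite -(pair_bigA _ (fun u b => F (u, b))); apply: eq_bigr => u _; rewrite big_bool addrC.
Qed.

(** The 2-by-2 block of the lift over an edge is the identity or the exchange
    matrix; both act by 1 on even and by (-1)^s on odd vectors. *)
Lemma biform_lift2 e (s : L -> L -> bool) (x y : L * bool -> R) :
  biform (adjf (lift2 e s)) x y =
  2 * (biform (adjf e) (even_part x) (even_part y)
       + biform (fun u v => (e u v)%:R * (-1) ^+ s u v) (odd_part x) (odd_part y)).
Proof.
rewrite /biform sum_pairb -big_split /= mulr_sumr; apply: eq_bigr => u _.
rewrite !sum_pairb -!big_split /= mulr_sumr; apply: eq_bigr => v _.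
rewrite /adjf /lift2 /even_part /odd_part /=.
by case: (e u v); case: (s u v) => /=; rewrite ?expr0 ?expr1; field.
Qed.

Lemma sqnorm_lift2 (x : L * bool -> R) :
  sqnorm x = 2 * (sqnorm (even_part x) + sqnorm (odd_part x)).
Proof.
rewrite /sqnorm sum_pairb -big_split mulr_sumr; apply: eq_bigr => u _.
by rewrite /even_part /odd_part /=; field.
Qed.

Lemma lift2_bound c e (s : L -> L -> bool) : form_bound c e ->
  (forall x y : L -> R, biform (fun u v => (e u v)%:R * (-1) ^+ s u v) x y
      <= c * (sqnorm x + sqnorm y)) ->
  form_bound c (lift2 e s).
Proof.
move=> ec sc x y x0 y0; rewrite biform_lift2 !sqnorm_lift2.
have even0 (z : L * bool -> R) : \sum_u z u = 0 -> \sum_u even_part z u = 0.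
  by rewrite sum_pairb /even_part -mulr_suml => ->; rewrite mul0r.
have := ec _ _ (even0 _ x0) (even0 _ y0); have := sc (odd_part x) (odd_part y).
by lra.
Qed.

(** Pairwise disjoint perfect matchings of the complete bipartite graph, of
    which f i0 lies in the graph of e and all the others in its bipartite
    complement. *)
Definition matching_family (M I : finType) (f : I -> M -> M) (i0 : I) (e : M -> M -> bool) :=
  [/\ forall i, injective (f i), forall u, injective (fun i => f i u) &
      forall i u, e u (f i u) = (i == i0)].

(** A matching f i has two lifts, indexed by c, each of which follows s over the
    edges u -- f i u up to the constant shift c.  Both avoid the lifted graph if
    f i avoids the graph; if f i lies in it, then the lift with c = false lies
    in the lifted graph and the one with c = true avoids it. *)
Lemma lift2_matchings (I : finType) (f : I -> L -> L) i0 e s :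
  matching_family f i0 e ->
  matching_family
    (fun (i : I * bool) (a : L * bool) =>
       (f i.1 a.1, a.2 (+) i.2 (+) s a.1 (f i.1 a.1)))
    (i0, false) (lift2 e s).
Proof.
move=> [finj disj fe]; split=> [[i c] [u a] [u' a'] /= []|[u a] [i c] [i' c'] /= []|[i c] [u a]].
- by move=> /finj-> /addIb/addIb->.
- by move=> /disj-> /addIb/addbI->.
by rewrite /lift2 /= fe xpair_eqE; case: (i == i0); case: a; case: c; case: (s _ _).
Qed.

End Lift.

(** * The tower of Ramanujan graphs *)

Section Tower.
Variables (R : realType) (q : nat).
Hypothesis q_gt0 : (0 < q)%N.

Fixpoint tower (m : nat) : finType :=
  if m is m'.+1 then (tower m' * bool)%type else 'I_q.+1.

Fixpoint matching_index (m : nat) : finType :=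
  if m is m'.+1 then (matching_index m' * bool)%type else unit.

Lemma card_tower m : #|tower m| = (q.+1 * 2 ^ m)%N.
Proof.
elim: m => [|m IHm] /=; first by rewrite card_ord muln1.
by rewrite card_prod IHm card_bool expnSr mulnA.
Qed.

Lemma card_matching_index m : #|matching_index m| = (2 ^ m)%N.
Proof.
elim: m => [|m IHm] /=; first by rewrite card_unit.
by rewrite card_prod IHm card_bool expnSr.
Qed.

(** The complete bipartite graph has the zero form on sum-zero vectors and the
    identity as its single recorded matching; each further step lifts by a
    signing from [bipartite_signing]. *)
Theorem ramanujan_tower m : exists (e : tower m -> tower m -> bool)
    (f : matching_index m -> tower m -> tower m) (i0 : matching_index m),
  [/\ biregular q.+1 e, form_bound (Num.sqrt q%:R : R) e & matching_family f i0 e].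
Proof.
elim: m => [|m [e [f [i0 [reg bound mat]]]]] /=.
  exists (fun _ _ => true), (fun _ u => u), tt; split.
  - by split=> u; rewrite -[RHS](card_ord q.+1); apply: eq_card => v; rewrite inE.
  - move=> x y x0 y0; rewrite /biform big1 => [|u _].
      by rewrite mulr_ge0 ?sqrtr_ge0 // addr_ge0 // sumr_ge0 // => v _; rewrite sqr_ge0.
    by rewrite -mulr_sumr -mulr_sumr y0 !mulr0.
  - by split=> [i u v|u [] []|[] u].
have [s sP] := bipartite_signing R q_gt0 reg.
exists (lift2 e s).
exists (fun (i : matching_index m * bool) (a : tower m * bool) =>
  (f i.1 a.1, a.2 (+) i.2 (+) s a.1 (f i.1 a.1))).
exists (i0, false); split.
- exact: lift2_biregular.
- exact: lift2_bound.
- exact: lift2_matchings.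
Qed.

End Tower.

(** * Adding perfect matchings *)

Section AddMatching.
Variables (R : realType) (L : finType).
Implicit Types (e : L -> L -> bool) (g : L -> L).

Definition add_match e g u v := e u v || (g u == v).

Lemma add_match_biregular d e g : injective g -> (forall u, ~~ e u (g u)) ->
  biregular d e -> biregular d.+1 (add_match e g).
Proof.
move=> ginj eg [regl regr]; split=> u.
  rewrite -(regl u) (_ : [set v | _] = g u |: [set v | e u v]).
    by rewrite cardsU1 inE eg.
  by apply/setP => v; rewrite !inE /add_match orbC eq_sym.
have [h gh hg] := injF_bij ginj.
rewrite -(regr u) (_ : [set v | _] = h u |: [set v | e v u]).
  by rewrite cardsU1 inE -{2}(hg u) eg.
by apply/setP => v; rewrite !inE /add_match orbC (can2_eq gh hg).
Qed.

(** The matching adds \sum_u x u * y (g u), which is at most half of the squared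
    norm of (x, y). *)
Lemma add_match_bound c e g : injective g -> (forall u, ~~ e u (g u)) ->
  @form_bound R L c e -> @form_bound R L (c + 1 / 2) (add_match e g).
Proof.
move=> ginj eg ec x y x0 y0.
have -> : biform (adjf R (add_match e g)) x y = biform (adjf R e) x y + \sum_u x u * y (g u).
  rewrite /biform -big_split; apply: eq_bigr => u _ /=.
  rewrite [in RHS](bigD1 (g u)) //= [in LHS](bigD1 (g u)) //=.
  rewrite /adjf /add_match eqxx orbT (negPf (eg u)) mul1r mul0r add0r addrC; congr (_ + _).
  by apply: eq_bigr => v vg; rewrite [g u == v]eq_sym (negPf vg) orbF.
have yg : sqnorm y = \sum_u y (g u) ^+ 2 by rewrite /sqnorm (reindex_inj ginj).
have : \sum_u x u * y (g u) <= (sqnorm x + sqnorm y) / 2.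
  rewrite yg /sqnorm -big_split /= mulr_suml; apply: ler_sum => u _.
  by have := sqr_ge0 (x u - y (g u)); nra.
by have := ec x y x0 y0; lra.
Qed.

End AddMatching.

Section BipartiteGraph.
Variables (L : finType).
Local Notation T := (L + L)%type.
Implicit Types (e : L -> L -> bool) (g : L -> L).

Definition bip_edges e : {set {set T}} :=
  [set [set (inl p.1 : T); inr p.2] | p : L * L & e p.1 p.2].

Lemma bip_edges_card2 e : [forall f in bip_edges e, #|f| == 2%N].
Proof. by apply/forall_inP => f /imsetP[p _ ->]; rewrite cards2. Qed.

Definition bip_graph e : sgraph T := SGraph (bip_edges_card2 e).

Definition bip_adj e (a b : T) : bool :=
  match a, b with inl u, inr v => e u v | inr v, inl u => e u v | _, _ => false end.

Lemma set_lr_inj u v u' v' :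
  [set (inl u : T); inr v] = [set inl u'; inr v'] -> u = u' /\ v = v'.
Proof.
move=> E; split.
  by have := set21 (inl u : T) (inr v); rewrite E => /set2P[[]|].
by have := set22 (inl u : T) (inr v); rewrite E => /set2P[|[]].
Qed.

Lemma bip_adjE e : adj (bip_graph e) =2 bip_adj e.
Proof.
have lr u v : ([set (inl u : T); inr v] \in bip_edges e) = e u v.
  apply/imsetP/idP => [[[u' v'] + /set_lr_inj[-> ->]]|euv]; first by rewrite inE.
  by exists (u, v); rewrite ?inE.
move=> [u|v] [u'|v']; rewrite /adj /= ?lr //; [|by rewrite setUC lr|].
  apply/imsetP => -[[a b] _ /setP/(_ (inr b))].
  by rewrite !inE eqxx.
apply/imsetP => -[[a b] _ /setP/(_ (inl a))].
by rewrite !inE eqxx.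
Qed.

Lemma bip_regular d e : biregular d e -> regular d (bip_graph e).
Proof.
move=> [regl regr] [u|v].
  rewrite -(regl u) -(card_imset _ (@inr_inj L L)); apply: eq_card => -[w|w].
    by rewrite inE bip_adjE; apply/esym/imsetP => -[].
  by rewrite inE bip_adjE mem_imset ?inE //; exact: inr_inj.
rewrite -(regr v) -(card_imset _ (@inl_inj L L)); apply: eq_card => -[w|w].
  by rewrite inE bip_adjE mem_imset ?inE //; exact: inl_inj.
by rewrite inE bip_adjE; apply/esym/imsetP => -[].
Qed.

Lemma bip_add_matching e g : injective g -> (forall u, ~~ e u (g u)) ->
  add_matching (bip_graph e) (bip_graph (add_match e g)).
Proof.
move=> ginj eg; pose V0 : {set T} := [set a | if a is inl _ then true else false].
pose F : {set {set T}} := [set [set (inl u : T); inr (g u)] | u : L].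
exists (bicompl (bip_graph e) V0), F; split.
- left; exists V0 => // -[u|u] [v|v]; rewrite bip_adjE !inE //.
- split.
    apply/subsetP => f /imsetP[u _ ->]; apply/imset2P.
    by exists (inl u) (inr (g u)); rewrite ?inE // bip_adjE eg.
  move=> a; have [u aE] : exists u, forall u',
      (a \in [set (inl u' : T); inr (g u')]) = (u' == u).
    case: a => [u|v]; first by exists u => u'; rewrite !inE orbF eq_sym.
    have [h gh hg] := injF_bij ginj; exists (h v) => u'; rewrite !inE /=.
    by rewrite -(can2_eq gh hg) eq_sym.
  rewrite (_ : [set f in F | _] = [set [set (inl u : T); inr (g u)]]) ?cards1 //.
  apply/setP => f; rewrite !inE; apply/andP/eqP => [[/imsetP[u' _ ->]]|->].
    by rewrite aE => /eqP->.
  by rewrite aE eqxx; split=> //; apply/imsetP; exists u.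
apply/setP => f; rewrite inE; apply/imsetP/orP => [[[u v] + ->]|[|] /imsetP[]].
- rewrite inE /= => /orP[euv|/eqP<-]; [left|right]; last by apply/imsetP; exists u.
  by apply/imsetP; exists (u, v); rewrite ?inE.
- by move=> [u v]; rewrite inE /= => euv ->; exists (u, v); rewrite // inE /add_match euv.
by move=> u _ ->; exists (u, g u); rewrite // inE /add_match eqxx orbT.
Qed.

End BipartiteGraph.

Section AddMany.
Variables (R : realType) (L I : finType) (f : I -> L -> L).
Hypothesis f_inj : forall i, injective (f i).
Hypothesis f_disj : forall u, injective (fun i => f i u).
Implicit Types (e : L -> L -> bool) (s : seq I).

Definition add_all e s := foldl (fun e i => add_match e (f i)) e s.

(** Disjointness of the matchings keeps the later ones in the complement after
    the earlier ones have been added. *)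
Lemma add_all_matchings e s d c : uniq s -> (forall i u, i \in s -> ~~ e u (f i u)) ->
  biregular d e -> @form_bound R L c e ->
  [/\ biregular (d + size s) (add_all e s),
      @form_bound R L (c + (size s)%:R / 2) (add_all e s),
      add_matchings (size s) (bip_graph e) (bip_graph (add_all e s)) &
      forall u v, e u v -> add_all e s u v].
Proof.
elim: s e d c => [|i s IHs] e d c /=.
  by rewrite addn0 mul0r addr0.
move=> /andP[is_ us] sP reg bound; have ei u : ~~ e u (f i u) by apply: sP; rewrite mem_head.
have sP' j u : j \in s -> ~~ add_match e (f i) u (f j u).
  move=> js; rewrite /add_match negb_or sP ?inE ?js ?orbT //=.
  by apply: contra is_ => /eqP/f_disj->.
have [reg' bound' add' sub'] := IHs _ _ _ us sP' (add_match_biregular (@f_inj i) ei reg)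
  (add_match_bound (@f_inj i) ei bound).
split.
- by rewrite -addSnnS.
- by rewrite -natr1 mulrDl [_ / 2 + _]addrC addrA.
- by exists (bip_graph (add_match e (f i))); split=> //; exact: bip_add_matching.
by move=> u v euv; apply: sub'; rewrite /add_match euv.
Qed.

End AddMany.

(** * The first two eigenvalues of a graph *)

Section GraphSpectrum.
Variables (R : realType) (T : finType) (X : sgraph T).

Lemma adj_sym : symmetric (adj X).
Proof. by move=> v w; rewrite /adj setUC. Qed.

Lemma adjmx_sym : (adjmx R X)^T = adjmx R X.
Proof. by apply/matrixP => i j; rewrite !mxE adj_sym. Qed.

Lemma spectrum_sorted : sorted >=%R (spectrum R X).
Proof.
by rewrite /spectrum rev_sorted; exact: root_list_sorted.
Qed.

Lemma spectrum_perm (s : seq R) :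
  char_poly (adjmx R X) = \prod_(z <- s) ('X - z%:P) -> perm_eq (spectrum R X) s.
Proof. by move=> E; rewrite /spectrum perm_rev E root_list_prod. Qed.

(** If the second entry of the decreasing list of eigenvalues exceeded c, so
    would the first, whereas at most one index of an eigenbasis has an
    eigenvalue beyond c. *)
Lemma lambda1_le c : 0 <= c ->
  (forall x, x *m const_mx 1 = 0 :> 'M_1 -> qform (adjmx R X) x <= c * (x *m x^T) 0 0) ->
  lambda R X 1 <= c.
Proof.
move=> c0 small; have [P [d [Pu AE]]] := spectral_sym adjmx_sym.
have one := qform_one_large adjmx_sym Pu AE small.
have perm := spectrum_perm (char_poly_diag Pu AE).
have sorted_s := spectrum_sorted.
rewrite leNgt; apply/negP; rewrite /lambda => lt_c.
have : (1 < count (fun z => (c < z)%R) (spectrum R X))%N.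
  case: (spectrum R X) sorted_s lt_c => [|a [|b r]] /=; rewrite ?ltNge ?c0 //.
  by rewrite -!ltNge => /andP[ba _] cb; rewrite cb (lt_le_trans cb ba).
rewrite (seq.permP perm) count_map -size_filter.
case E : (filter _ _) => [|i [|j r]] //= _.
have : uniq (i :: j :: r) by rewrite -E filter_uniq // enum_uniq.
have : i \in i :: j :: r by rewrite mem_head.
have : j \in i :: j :: r by rewrite !inE eqxx orbT.
rewrite -{1 2}E !mem_filter /= => /andP[cj _] /andP[ci _].
by rewrite (one i j ci cj) inE eqxx.
Qed.

Lemma adjmx_rowsum k i : regular k X -> \sum_j adjmx R X i j = k%:R.
Proof.
move=> reg; rewrite -(reg (enum_val i)) -sum1_card natr_sum [RHS]big_mkcond /=.
rewrite [RHS](reindex (@enum_val T T)) /=; last exact/onW_bij/enum_val_bij.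
by apply: eq_bigr => j _; rewrite mxE inE; case: ifP.
Qed.

Lemma sqnorm_gt0 n (x : 'rV[R]_n) : x != 0 -> 0 < (x *m x^T) 0 0.
Proof.
move=> x0; have [i xi] : exists i, x 0 i != 0.
  apply/existsP; apply: contraR x0; rewrite negb_exists => /forallP x0.
  by apply/eqP/rowP => i; rewrite mxE; apply/eqP; rewrite -[_ == _]negbK.
rewrite mxE (bigD1 i) //= mxE -expr2 ltr_pwDl //.
  by rewrite lt_neqAle eq_sym sqrf_eq0 xi sqr_ge0.
by rewrite sumr_ge0 // => j _; rewrite mxE -expr2 sqr_ge0.
Qed.

Lemma qform_regular_le k x : regular k X ->
  qform (adjmx R X) x <= k%:R * (x *m x^T) 0 0.
Proof.
move=> reg; have -> : k%:R * (x *m x^T) 0 0 =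
    \sum_j \sum_i adjmx R X i j * ((x 0 i ^+ 2 + x 0 j ^+ 2) / 2).
  have half : \sum_j \sum_i adjmx R X i j * (x 0 j ^+ 2 / 2) = k%:R * (x *m x^T) 0 0 / 2.
    rewrite mxE mulr_sumr mulr_suml; apply: eq_bigr => j _.
    rewrite -mulr_suml -[RHS]mulrA mxE -expr2; congr (_ * _).
    by rewrite -(adjmx_rowsum j reg); apply: eq_bigr => i _; rewrite -[in LHS]adjmx_sym mxE.
  have half' : \sum_j \sum_i adjmx R X i j * (x 0 i ^+ 2 / 2) = k%:R * (x *m x^T) 0 0 / 2.
    rewrite -half exchange_big; apply: eq_bigr => i _; apply: eq_bigr => j _.
    by rewrite -[in LHS]adjmx_sym mxE.
  rewrite [LHS]splitr -{1}half' -half -big_split; apply: eq_bigr => j _ /=.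
  by rewrite -big_split; apply: eq_bigr => i _ /=; rewrite -mulrDr -mulrDl.
rewrite /qform mxE; apply: ler_sum => j _; rewrite mxE mulr_suml; apply: ler_sum => i _.
rewrite [x^T _ _]mxE mulrAC mulrC ler_wpM2l //; first by rewrite mxE ler0n.
by have := sqr_ge0 (x 0 i - x 0 j); nra.
Qed.

Lemma qform_eigen (x : 'rV[R]_#|T|) mu : x *m adjmx R X = mu *: x ->
  qform (adjmx R X) x = mu * (x *m x^T) 0 0.
Proof. by move=> xA; rewrite /qform xA -scalemxAl mxE. Qed.

Lemma mem_spectrum mu : (mu \in spectrum R X) = eigenvalue (adjmx R X) mu.
Proof.
have [P [d [Pu AE]]] := spectral_sym adjmx_sym.
rewrite eigenvalue_root_char (perm_mem (spectrum_perm (char_poly_diag Pu AE))).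
by rewrite (char_poly_diag Pu AE) root_prod_XsubC.
Qed.

Lemma lambda0_regular k : regular k X -> (0 < #|T|)%N -> lambda R X 0 = k%:R.
Proof.
move=> reg T0; have k_spec : k%:R \in spectrum R X.
  rewrite mem_spectrum; apply/eigenvalueP; exists (const_mx 1).
    apply/rowP => j; rewrite !mxE mulr1 -(adjmx_rowsum j reg).
    by apply: eq_bigr => i _; rewrite mxE mul1r -[in LHS]adjmx_sym mxE.
  by apply/eqP => /rowP/(_ (Ordinal T0)); rewrite !mxE => /eqP; rewrite oner_eq0.
have spec_le z : z \in spectrum R X -> z <= k%:R.
  rewrite mem_spectrum => /eigenvalueP[x xA x0].
  by rewrite -(ler_pM2r (sqnorm_gt0 x0)) -(qform_eigen xA) qform_regular_le.
have := spectrum_sorted; rewrite /lambda.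
case: (spectrum R X) k_spec spec_le => [//|a r] kr le_k sr.
apply/eqP; rewrite eq_le le_k ?mem_head //=.
move: kr; rewrite inE => /predU1P[->//|kr].
by have /allP := order_path_min (rev_trans le_trans) sr; apply.
Qed.

End GraphSpectrum.

(** * Spectrum and connectedness of biregular bipartite graphs *)

Section BipartiteSpectrum.
Variables (R : realType) (L : finType) (e : L -> L -> bool) (d : nat) (c : R).
Hypothesis reg : biregular d e.
Hypothesis bound : form_bound c e.
Local Notation T := (L + L)%type.
Local Notation w := (adjf R e).
Implicit Types x y : L -> R.

Lemma adjmx_bip : adjmx R (bip_graph e) = bipartite_mx w.
Proof.
apply/matrixP => i j; rewrite !mxE bip_adjE /bip_adj /bipartite_fun /adjf.
by case: (enum_val i); case: (enum_val j).
Qed.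

Lemma adjf_rowsum u : \sum_v w u v = d%:R.
Proof.
rewrite -(reg.1 u) -sum1_card natr_sum [RHS]big_mkcond /=.
by apply: eq_bigr => v _; rewrite inE /adjf; case: (e u v).
Qed.

Lemma adjf_colsum v : \sum_u w u v = d%:R.
Proof.
rewrite -(reg.2 v) -sum1_card natr_sum [RHS]big_mkcond /=.
by apply: eq_bigr => u _; rewrite inE /adjf; case: (e u v).
Qed.

Lemma sum_adjf_left x : \sum_u \sum_v w u v * x u = d%:R * \sum_u x u.
Proof.
by rewrite mulr_sumr; apply: eq_bigr => u _; rewrite -mulr_suml adjf_rowsum.
Qed.

Lemma sum_adjf_right y : \sum_u \sum_v w u v * y v = d%:R * \sum_v y v.
Proof.
rewrite exchange_big mulr_sumr; apply: eq_bigr => v _.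
by rewrite -mulr_suml adjf_colsum.
Qed.

Lemma biform_shift x y m : \sum_u x u = 0 -> \sum_v y v = 0 ->
  biform w (fun u => x u + m) (fun v => y v - m) = biform w x y - d%:R * (#|L|%:R * m ^+ 2).
Proof.
move=> x0 y0.
have -> : d%:R * (#|L|%:R * m ^+ 2) = \sum_u \sum_v w u v * (fun=> m ^+ 2) u.
  by rewrite sum_adjf_left sumr_const -[_ *+ #|_|]mulr_natl.
have -> : biform w x y = biform w x y + m * (\sum_u \sum_v w u v * y v)
                         - m * (\sum_u \sum_v w u v * x u).
  by rewrite sum_adjf_left sum_adjf_right x0 y0 !mulr0 addr0 subr0.
rewrite !mulr_sumr /biform -big_split -!sumrB /=; apply: eq_bigr => u _.
rewrite !mulr_sumr -big_split -!sumrB /=; apply: eq_bigr => v _.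
by ring.
Qed.

Lemma sqnorm_shift x m : \sum_u x u = 0 ->
  sqnorm (fun u => x u + m) = sqnorm x + #|L|%:R * m ^+ 2.
Proof.
move=> x0; rewrite /sqnorm.
have -> : \sum_u (x u + m) ^+ 2 = \sum_u x u ^+ 2 + \sum_u x u * (2 * m) + \sum_(u : L) m ^+ 2.
  by rewrite -!big_split; apply: eq_bigr => u _ /=; ring.
by rewrite -mulr_suml x0 mul0r addr0 sumr_const mulr_natl.
Qed.


Lemma sum_center x : (0 < #|L|)%N -> \sum_u (x u - (\sum_v x v) / #|L|%:R) = 0.
Proof.
move=> L0; rewrite sumrB sumr_const -[X in _ - X]mulr_natr divfK ?subrr //.
by rewrite pnatr_eq0 -lt0n.
Qed.

(** A vector (x, y) orthogonal to the constants is (x' + m, y' - m) for sum-zero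
    x' and y'; the part (m, - m) is an eigenvector for - d and only decreases
    the form. *)
Lemma bip_lambda1 : 0 <= c -> (0 < #|L|)%N -> lambda R (bip_graph e) 1 <= 2 * c.
Proof.
move=> c0 L0; apply: lambda1_le => [|z z1]; first by rewrite mulr_ge0.
rewrite adjmx_bip qform_bipartite sqnorm_parts -mulrA ler_pM2l ?ltr0n //.
set x := left_part z; set y := right_part z.
have xy0 : \sum_u x u + \sum_v y v = 0.
  move/matrixP: z1 => /(_ 0 0); rewrite !mxE sum_rank => E.
  by rewrite -[RHS]E; congr (_ + _); apply: eq_bigr => u _; rewrite mxE mulr1.
pose m := (\sum_v x v) / #|L|%:R.
have my : (\sum_v y v) / #|L|%:R = - m.
  by move/eqP: xy0; rewrite addrC addr_eq0 => /eqP->; rewrite mulNr.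
pose x' u := x u - m; pose y' v := y v + m.
have x'0 : \sum_u x' u = 0 by exact: sum_center.
have y'0 : \sum_v y' v = 0 by rewrite -[RHS](sum_center y L0) my opprK.
have xE : x =1 (fun u => x' u + m) by move=> u; rewrite /x' subrK.
have yE : y =1 (fun v => y' v - m) by move=> v; rewrite /y' addrK.
rewrite (eq_biform _ xE yE) (eq_sqnorm xE) (eq_sqnorm yE) biform_shift //.
rewrite (sqnorm_shift m x'0) (sqnorm_shift (- m) y'0) sqrrN.
have h1 := bound x'0 y'0.
have h2 : 0 <= #|L|%:R * m ^+ 2 by rewrite mulr_ge0 ?sqr_ge0.
have h3 : 0 <= d%:R * (#|L|%:R * m ^+ 2) by rewrite mulr_ge0.
have h4 : 0 <= c * (#|L|%:R * m ^+ 2) by rewrite mulr_ge0.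
by lra.
Qed.

(** Summing the eigenvector equation over each part shows that an eigenvector
    for mu different from d and - d has sum zero on both parts; the bound is
    then applied to (x, y) and to (x, - y). *)
Lemma bip_eigenvalue (mu : R) : eigenvalue (adjmx R (bip_graph e)) mu ->
  mu != d%:R -> mu != - d%:R -> `|mu| <= 2 * c.
Proof.
move=> /eigenvalueP[z zA z0] mud muNd.
set x := left_part z; set y := right_part z.
have eigl u : \sum_v w u v * y v = mu * x u.
  move/rowP: (zA) => /(_ (enum_rank (inl u : T))); rewrite adjmx_bip !mxE sum_rank => <-.
  rewrite [X in _ = X + _]big1 ?add0r => [|u' _]; last by rewrite !mxE !enum_rankK /= mulr0.
  by apply: eq_bigr => v _; rewrite !mxE !enum_rankK /= mulrC.
have eigr v : \sum_u w u v * x u = mu * y v.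
  move/rowP: (zA) => /(_ (enum_rank (inr v : T))); rewrite adjmx_bip !mxE sum_rank => <-.
  rewrite [X in _ = _ + X]big1 ?addr0 => [|u' _]; last by rewrite !mxE !enum_rankK /= mulr0.
  by apply: eq_bigr => u _; rewrite !mxE !enum_rankK /= mulrC.
have sumx : d%:R * \sum_v y v = mu * \sum_u x u.
  by rewrite -sum_adjf_right mulr_sumr; apply: eq_bigr => u _.
have sumy : d%:R * \sum_u x u = mu * \sum_v y v.
  by rewrite -sum_adjf_left exchange_big mulr_sumr; apply: eq_bigr => u _.
have sum0 : \sum_u x u + \sum_v y v = 0.
  apply/eqP; rewrite -(mulrI_eq0 _ (mulfI (_ : mu - d%:R != 0))) ?subr_eq0 //.
  by apply/eqP; rewrite mulrBl !mulrDr sumx sumy; ring.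
have dif0 : \sum_u x u - \sum_v y v = 0.
  apply/eqP; rewrite -(mulrI_eq0 _ (mulfI (_ : mu + d%:R != 0))) ?addr_eq0 //.
  by apply/eqP; rewrite mulrDl !mulrBr sumx sumy; ring.
have x0 : \sum_u x u = 0 by lra.
have y0 : \sum_v y v = 0 by lra.
have form : 2 * biform w x y = mu * (sqnorm x + sqnorm y).
  by rewrite -qform_bipartite -adjmx_bip (qform_eigen zA) sqnorm_parts.
have norm0 : 0 < sqnorm x + sqnorm y by rewrite -sqnorm_parts sqnorm_gt0.
have yN0 : \sum_v - y v = 0 by rewrite sumrN y0 oppr0.
have formN : biform w x (fun v => - y v) = - biform w x y.
  rewrite /biform -sumrN; apply: eq_bigr => u _; rewrite -sumrN.
  by apply: eq_bigr => v _; rewrite !mulrN.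
have normN : sqnorm (fun v => - y v) = sqnorm y.
  by apply: eq_bigr => v _; rewrite sqrrN.
have h1 := bound x0 y0; have := bound x0 yN0; rewrite formN normN => h2.
rewrite ler_norml; apply/andP; split.
  by rewrite -(ler_pM2r norm0) -form; lra.
by rewrite -(ler_pM2r norm0) -form; lra.
Qed.

(** The indicator function S of a connected component, centred on each part,
    satisfies the equation of an eigenvector for d.  As d > 2 c, the bound
    forces it to vanish, so that S is constant. *)
Lemma bip_connected : 0 <= c -> 2 * c < d%:R -> (0 < #|L|)%N -> connected (bip_graph e).
Proof.
move=> c0 cd L0; split; first by rewrite card_sum addn_gt0 L0.
move=> a b; pose S (a' : T) : R := (connect (adj (bip_graph e)) a a')%:R.
have S_edge u v : w u v * S (inl u) = w u v * S (inr v).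
  rewrite /adjf; case euv: (e u v); rewrite ?mul0r // /S; congr (_ * _%:R).
  have uv : adj (bip_graph e) (inl u) (inr v) by rewrite bip_adjE.
  have vu : adj (bip_graph e) (inr v) (inl u) by rewrite bip_adjE.
  by congr nat_of_bool; apply/idP/idP => /connect_trans; apply; exact: connect1.
pose mx := (\sum_u S (inl u)) / #|L|%:R; pose my := (\sum_v S (inr v)) / #|L|%:R.
pose x u := S (inl u) - mx; pose y v := S (inr v) - my.
have x0 : \sum_u x u = 0 by exact: (sum_center (fun u => S (inl u))).
have y0 : \sum_v y v = 0 by exact: (sum_center (fun v => S (inr v))).
have d0 : 0 < d%:R :> R by lra.
have mxy : mx = my.
  congr (_ / _); apply: (mulfI (lt0r_neq0 d0)).
  rewrite -(sum_adjf_left (fun u => S (inl u))) -(sum_adjf_right (fun v => S (inr v))).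
  by apply: eq_bigr => u _; apply: eq_bigr => v _.
have xy u v : w u v * x u = w u v * y v by rewrite !mulrBr S_edge mxy.
have formx : biform w x y = d%:R * sqnorm x.
  rewrite /sqnorm -(sum_adjf_left (fun u => x u ^+ 2)).
  apply: eq_bigr => u _; apply: eq_bigr => v _.
  by rewrite expr2 mulrCA -xy mulrCA.
have formy : biform w x y = d%:R * sqnorm y.
  rewrite /sqnorm -(sum_adjf_right (fun v => y v ^+ 2)).
  apply: eq_bigr => u _; apply: eq_bigr => v _.
  by rewrite expr2 !mulrA xy.
have sq0 (z : L -> R) : 0 <= sqnorm z by rewrite sumr_ge0 // => u _; rewrite sqr_ge0.
have hb := bound x0 y0; have hx := sq0 x; have hy := sq0 y.
have le0 : sqnorm x + sqnorm y <= 0.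
  have cd0 : 0 < d%:R - 2 * c by rewrite subr_gt0.
  rewrite -(pmulr_rle0 _ cd0) mulrBl mulrDr -formx -formy; lra.
have sx0 : sqnorm x = 0 by lra.
have sy0 : sqnorm y = 0 by lra.
have zero (z : L -> R) : sqnorm z = 0 -> forall u, z u = 0.
  move=> sz u; apply/eqP; rewrite -sqrf_eq0; apply/eqP.
  by apply: (psumr_eq0P _ sz) => // v _; rewrite sqr_ge0.
have SE a' : S a' = mx.
  case: a' => [u|v]; first by have /eqP := zero x sx0 u; rewrite subr_eq0 => /eqP.
  by have /eqP := zero y sy0 v; rewrite subr_eq0 mxy => /eqP.
have : S b = S a by rewrite !SE.
by rewrite /S connect0 => /eqP; rewrite eqr_nat; case: (connect _ a b).
Qed.

End BipartiteSpectrum.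

(** * The sequences of graphs *)

Section Main.
Variable R : realType.

Lemma sqrt_lt_succ q : (1 < q)%N -> 2 * Num.sqrt q%:R < q.+1%:R :> R.
Proof.
move=> q1; have sq : Num.sqrt q%:R ^+ 2 = q%:R :> R by rewrite sqr_sqrtr.
have s0 : 0 <= Num.sqrt q%:R :> R by exact: sqrtr_ge0.
have s1 : 1 < Num.sqrt q%:R :> R.
  by rewrite -(@ltr_pXn2r _ 2) ?nnegrE // sq expr1n ltr1n.
have : 0 < (Num.sqrt q%:R - 1) ^+ 2 :> R by rewrite exprn_gt0 // subr_gt0.
by rewrite sqrrB1 sq -natr1 -mulr_natl; lra.
Qed.

(** The i-th graph is built on the level t + i of the tower, which has
    2 ^ (t + i) - 1 >= t disjoint perfect matchings in its complement. *)
Theorem matched_ramanujan q t : (1 < q)%N ->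
  exists (V : nat -> finType) (X : forall i, sgraph (V i)),
    (forall i j, (i < j)%N -> (#|V i| < #|V j|)%N) /\
    (forall i, [/\ connected (X i), regular (q.+1 + t) (X i),
       exists Y : sgraph (V i), ramanujan R q.+1 Y /\ add_matchings t Y (X i) &
       lambda R (X i) 1 <= t%:R + 2 * Num.sqrt q%:R]).
Proof.
move=> q1; have q0 : (0 < q)%N by exact: ltnW.
pose V i : finType := (tower q (t + i) + tower q (t + i))%type.
suff /(_ _)/cid-/all_sig[X XP] : forall i, exists X : sgraph (V i),
    [/\ connected X, regular (q.+1 + t) X,
        exists Y : sgraph (V i), ramanujan R q.+1 Y /\ add_matchings t Y X &
        lambda R X 1 <= t%:R + 2 * Num.sqrt q%:R].
  exists V, X; split=> // i j ij.
  rewrite /V !card_sum !card_tower -!mulnDr.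
  have lt_pow : (2 ^ (t + i) < 2 ^ (t + j))%N by rewrite ltn_exp2l // ltn_add2l.
  by rewrite ltn_pmul2l // (ltn_trans (n := 2 ^ (t + j) + 2 ^ (t + i))) // ?ltn_add2r ?ltn_add2l.
move=> i; have [e [f [i0 [reg bound [f_inj f_disj fe]]]]] := ramanujan_tower R q0 (t + i).
pose I := matching_index (t + i).
pose s := take t (rem i0 (enum I)).
have uI : uniq (enum I) by exact: enum_uniq.
have us : uniq s by rewrite take_uniq // rem_uniq.
have size_s : size s = t.
  rewrite size_take size_rem ?mem_enum // -cardE card_matching_index.
  have := ltn_expl (t + i) (ltnSn 1); move: (2 ^ (t + i))%N => N lt_N.
  by case: ltnP => // le_t; lia.
have s_i0 j u : j \in s -> ~~ e u (f j u).
  move=> js; rewrite fe; apply: contraTneq js => ->.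
  by apply: contraNN (_ : i0 \notin rem i0 (enum I)) => [/mem_take|]; rewrite ?mem_rem_uniqF.
have [reg' bound' added sub] := add_all_matchings f_inj f_disj us s_i0 reg bound.
rewrite size_s in reg' bound' added.
have L0 : (0 < #|tower q (t + i)|)%N by rewrite card_tower muln_gt0 expn_gt0.
have c0 : 0 <= Num.sqrt q%:R :> R by exact: sqrtr_ge0.
have conn : connected (bip_graph e) by apply: (bip_connected reg bound) => //; exact: sqrt_lt_succ.
exists (bip_graph (add_all f e s)); split.
- split=> [|a b]; first by case: conn.
  apply: connect_sub (conn.2 a b) => x y; rewrite bip_adjE => xy; apply: connect1.
  by rewrite bip_adjE; case: x y xy => [u|u] [v|v] //=; exact: sub.
- exact: bip_regular.
- exists (bip_graph e); split=> //; split=> //; first exact: bip_regular.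
  move=> mu mu_eig mud muNd; rewrite -[q.+1%:R]natr1 addrK.
  exact: (bip_eigenvalue reg bound).
have c0' : 0 <= Num.sqrt q%:R + t%:R / 2 :> R by rewrite addr_ge0 ?divr_ge0.
by apply: le_trans (bip_lambda1 reg' bound' c0' L0) _; lra.
Qed.

End Main.

Theorem mainTheorem2 (R : realType) :
  (forall (k l : nat) (K : finFieldType),
     (3 <= k)%N -> (1 <= l)%N -> #|K| = (k - l)%N ->
     exists (V : nat -> finType) (X : forall i : nat, sgraph (V i)),
       (forall i j : nat, (i < j)%N -> (#|V i| < #|V j|)%N) /\
       (forall i : nat,
          [/\ connected (X i), regular k (X i),
              exists Y : sgraph (V i),
                ramanujan R (k - l + 1) Y /\ add_matchings (l - 1) Y (X i) &
              lambda R (X i) 1 <= l%:R - 1 + 2 * Num.sqrt (k - l)%:R])) /\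
  (exists (V : nat -> finType) (X : forall i : nat, sgraph (V i)),
     (forall i j : nat, (i < j)%N -> (#|V i| < #|V j|)%N) /\
     (forall i : nat,
        [/\ connected (X i), regular 7 (X i),
            exists Y : sgraph (V i),
              ramanujan R 6 Y /\ add_matching Y (X i) &
            spectral_gap R (X i) = 7 - lambda R (X i) 1 /\
            6 - 2 * Num.sqrt 5 <= 7 - lambda R (X i) 1])).
Proof.
split=> [k l K k3 l1 cardK|].
  have q1 : (1 < k - l)%N by rewrite -cardK card_finNzRing_gt1.
  have [V [X [incr XP]]] := matched_ramanujan R (l - 1) q1.
  exists V, X; split=> // i; have [conn reg ram lam] := XP i; split=> //.
  - by have -> : k = ((k - l).+1 + (l - 1))%N by lia.
  - by rewrite addn1.
  by rewrite (natrB _ l1) in lam.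
have [V [X [incr XP]]] := @matched_ramanujan R 5 1 isT.
exists V, X; split=> // i; have [conn reg [Y [ramY [Z [addZ XZ]]]] lam] := XP i; split=> //.
  by exists Y; rewrite XZ.
have [V0 _] := conn; split; first by rewrite /spectral_gap (lambda0_regular R reg V0).
by lra.
Qed.
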